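(* Let $f\ge 0$ be a solution of $\partial_t f+\xi\cdot\nabla_x f=I(f,x,\xi,t)$, $f(x,\xi,0)=f_0(x,\xi)$, where $I$ is a mesoscopic interaction, such that $f$ has finite mass, energy and momentum at time zero and $\int_{\mathbb{R}^n}\int_{\mathbb{R}^n} f(x,\xi,0)|x|^2\,dx\,d\xi<\infty$. Then the relative angular norm of $f$ satisfies $$\|f\|_G\le\int_{\mathbb{R}^n}\int_{\mathbb{R}^n} f(x,\xi,0)(|x|^2+|\xi|^2)\,dx\,d\xi-\int_{\mathbb{R}^n}\int_{\mathbb{R}^n} f(x,\xi,0)\,x\cdot\xi\,dx\,d\xi.$$ Furthermore, the uncertainty goes to infinity with time: $\lim_{t\to\infty}U(t)=\infty$.
   Context: Here $x,\xi\in\mathbb{R}^n$, $t\in[0,\infty)$, and $f=f(x,\xi,t)$ is non-negative. The equation is equivalently understood along characteristics: $\frac{d}{dt}f(x+t\xi,\xi,t)=I(f,x+t\xi,\xi,t)$, $f(x,\xi,0)=f_0(x,\xi)$. $I(f,x,\xi,t)$ is a mesoscopic interaction if $\int_{\mathbb{R}^n} I(f,x,\xi,t)\,d\xi=0$, $\int_{\mathbb{R}^n} I(f,x,\xi,t)|\xi|^2\,d\xi=0$ and $\int_{\mathbb{R}^n} I(f,x,\xi,t)\xi_i\,d\xi=0$ for $1\le i\le n$. Mass, energy and momentum at time zero are $\mathbf{M}=\iint f(x,\xi,0)\,dx\,d\xi$, $\mathbf{E}=\iint f(x,\xi,0)|\xi|^2\,dx\,d\xi$, $\mathbf{V}=\iint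 f(x,\xi,0)\xi\,dx\,d\xi$ (integrals over $\mathbb{R}^n\times\mathbb{R}^n$). As a consequence of the definition of mesoscopic interaction these quantities remain invariant over time. Angular momentum: $A(t)=\int_{\mathbb{R}^n}\int_{\mathbb{R}^n} f(x,\xi,t)\,x\cdot\xi\,dx\,d\xi$. Uncertainty: $U(t)=\int_{\mathbb{R}^n}\int_{\mathbb{R}^n} f(x,\xi,t)|x||\xi|\,dx\,d\xi$. Relative angular norm: $\|f\|_G=\sup_{t}\big(U(t)-A(t)\big)$.
   Formalization: Added: f and I(f) are measurable, the integral of |I|(1+|ξ|²) over [0,T]×R^n×R^n is finite for every T (otherwise energy may escape and the claim fails), and positive mass is assumed for U(t)→∞ (false for f=0). *)

(* Defs.v *)
From HB Require Import structures.
From mathcomp Require Export all_boot all_order all_algebra.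
From mathcomp Require Export all_classical all_reals all_analysis.

Set Implicit Arguments.
Unset Strict Implicit.
Unset Printing Implicit Defensive.

Export Order.TTheory GRing.Theory Num.Theory.
Export numFieldNormedType.Exports.

Global Open Scope classical_set_scope.
Global Open Scope ring_scope.

(* The library puts neither a sigma-algebra nor Lebesgue measure on row
   vectors.  The sigma-algebra below is the one generated by the coordinates,
   as the library does for n.-tuple T; on R^n it is the Borel one. *)
Definition measure_rV_display : measure_display -> measure_display.
Proof. exact. Qed.

Section measurable_rV.
Context {d} {T : measurableType d}.
Variable n : nat.

Let coord : 'I_n -> 'rV[T]_n -> T := fun i x => x ord0 i.

Let rV_set0 : g_sigma_preimage coord set0.
Proof. exact: sigma_algebra0. Qed.

Let rV_setC A : g_sigma_preimage coord A -> g_sigma_preimage coord (~` A).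
Proof. exact: sigma_algebraC. Qed.

Let rV_bigcup (F : (set 'rV[T]_n)^nat) :
  (forall i, g_sigma_preimage coord (F i)) ->
  g_sigma_preimage coord (\bigcup_i (F i)).
Proof. exact: sigma_algebra_bigcup. Qed.

HB.instance Definition _ := @isMeasurable.Build (measure_rV_display d)
  'rV[T]_n (g_sigma_preimage coord) rV_set0 rV_setC rV_bigcup.

End measurable_rV.

Lemma measurable_coord d (T : measurableType d) n (i : 'I_n) :
  measurable_fun [set: 'rV[T]_n] (fun x : 'rV[T]_n => x ord0 i).
Proof.
move=> _ Y mY; rewrite setTI; apply: sub_sigma_algebra => /=.
rewrite -bigcup_seq/=; exists i => /=; first by rewrite mem_index_enum.
by exists Y => //; rewrite setTI.
Qed.

Lemma measurable_rVP d1 d2 (T1 : measurableType d1) (T2 : measurableType d2) n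
    (f : T1 -> 'rV[T2]_n) :
  (forall i, measurable_fun [set: T1] (fun x => f x ord0 i)) ->
  measurable_fun [set: T1] f.
Proof.
move=> mf; pose c := fun (i : 'I_n) (x : 'rV[T2]_n) => x ord0 i.
suff H : g_sigma_preimage (fun i => c i \o f) `<=` measurable.
  by move=> _ A mA; apply: H; rewrite g_sigma_preimage_comp; exists A.
apply: smallest_sub; first exact: sigma_algebra_measurable.
case: n => [|n] in f mf c *; first by rewrite big_ord0.
rewrite -bigcup_mkord_ord; apply: bigcup_sub => i Ii.
by move=> A [B mB <-]; exact: mf.
Qed.

(* Lebesgue measure on R^n, by induction on n: R^n.+1 is identified with
   R * R^n by splitting off the first coordinate. *)
Section lebesgue_rV_step.
Context {R : realType} (n : nat).
Variable mu : {sigma_finite_measure set 'rV[R]_n -> \bar R}.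

Definition rV_cons (p : measurableTypeR R * 'rV[R]_n) : 'rV[R]_n.+1 :=
  \row_i oapp (p.2 ord0) p.1 (unlift ord0 i).

Definition rV_uncons (v : 'rV[R]_n.+1) : measurableTypeR R * 'rV[R]_n :=
  (v ord0 ord0, \row_i v ord0 (lift ord0 i)).

Lemma rV_consK : cancel rV_cons rV_uncons.
Proof.
case=> a v; rewrite /rV_uncons /rV_cons; congr pair.
  by rewrite mxE unlift_none.
by apply/rowP => i; rewrite !mxE liftK.
Qed.

Lemma measurable_rV_cons : measurable_fun setT rV_cons.
Proof.
apply: measurable_rVP => i; rewrite /rV_cons.
under eq_fun do rewrite mxE.
case: unliftP => [j _|_] /=; last exact: measurable_fst.
by apply: (measurableT_comp (measurable_coord j)); exact: measurable_snd.
Qed.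

Lemma measurable_rV_uncons : measurable_fun setT rV_uncons.
Proof.
apply/measurable_fun_pairP; split; first exact: measurable_coord.
apply: measurable_rVP => i /=; under eq_fun do rewrite mxE.
exact: measurable_coord.
Qed.

Definition lebesgue_rV_step : set 'rV[R]_n.+1 -> \bar R :=
  pushforward (@lebesgue_measure R \x mu)%E rV_cons.

Let step0 : lebesgue_rV_step set0 = 0%E.
Proof. by rewrite /lebesgue_rV_step /pushforward preimage_set0 measure0. Qed.

Let step_ge0 A : (0 <= lebesgue_rV_step A)%E.
Proof. by rewrite /lebesgue_rV_step /pushforward measure_ge0. Qed.

Let step_sigma_additive : semi_sigma_additive lebesgue_rV_step.
Proof.
move=> F mF tF mUF; rewrite /lebesgue_rV_step /pushforward preimage_bigcup.
have mc A : measurable A -> measurable (rV_cons @^-1` A).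
  by move=> mA; rewrite -[X in measurable X]setTI; exact: measurable_rV_cons.
apply: measure_semi_sigma_additive.
- by move=> k; exact: mc.
- apply/trivIsetP => /= i j _ _ ij; rewrite -preimage_setI.
  by move/trivIsetP : tF => /(_ _ _ _ _ ij) ->//; rewrite preimage_set0.
- by rewrite -preimage_bigcup; exact: mc.
Qed.

HB.instance Definition _ := isMeasure.Build _ _ _
  lebesgue_rV_step step0 step_ge0 step_sigma_additive.

Let sigma_finite_step : sigma_finite setT lebesgue_rV_step.
Proof.
have /sigma_finiteP[F [FT ndF Foo]] := sigma_finiteT (@lebesgue_measure R).
have /sigma_finiteP[G [GT ndG Goo]] := sigma_finiteT mu.
exists (fun k => rV_uncons @^-1` (F k `*` G k)).
  rewrite -preimage_bigcup -(preimage_setT rV_uncons); congr (_ @^-1` _).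
  rewrite -setXTT FT GT predeqE => -[x y]; split.
    move=> [/= [k _ Fkx] [l _ Gly]]; exists (maxn k l) => //; split.
    - by move: x Fkx; exact/subsetPset/ndF/leq_maxl.
    - by move: y Gly; exact/subsetPset/ndG/leq_maxr.
  by move=> [k _ []/= ? ?]; split; exists k.
move=> k; have [mF Fk] := Foo k; have [mG Gk] := Goo k; split.
  rewrite -[X in measurable X]setTI.
  by apply: measurable_rV_uncons => //; exact: measurableX.
rewrite /lebesgue_rV_step /pushforward -comp_preimage.
rewrite (_ : rV_uncons \o rV_cons = id) ?preimage_id; last first.
  by apply/funext => x /=; rewrite rV_consK.
by rewrite product_measure1E// lte_mul_pinfty// ge0_fin_numE.
Qed.

HB.instance Definition _ := @Measure_isSigmaFinite.Build _ _ _
  lebesgue_rV_step sigma_finite_step.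

End lebesgue_rV_step.

Fixpoint lebesgue_rV (R : realType) (n : nat) :
    {sigma_finite_measure set 'rV[R]_n -> \bar R} :=
  match n with
  | 0 => (dirac (0 : 'rV[R]_0))
  | m.+1 => lebesgue_rV_step (lebesgue_rV R m)
  end.

Section kinetic.
Context {R : realType} {n : nat}.
Local Notation V := 'rV[R]_n.
Local Notation lambda := (lebesgue_rV R n).

(* Euclidean structure; the library norm on matrices is the sup norm. *)
Definition dotv (x y : V) : R := \sum_i x ord0 i * y ord0 i.
Definition enorm (x : V) : R := Num.sqrt (dotv x x).

Implicit Type f : V -> V -> R -> R.
Implicit Type I : (V -> V -> R -> R) -> V -> V -> R -> R.

(* A measurable function whose positive and negative parts both have infinite
   integral has integral -oo here, so each equation below also says that the
   integral converges absolutely. *)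
Definition mesoscopic_interaction I f : Prop :=
  forall (x : V) (t : R), 0 <= t ->
  [/\ (\int[lambda]_xi (I f x xi t)%:E = 0)%E,
      (\int[lambda]_xi (I f x xi t * enorm xi ^+ 2)%:E = 0)%E &
      forall i, (\int[lambda]_xi (I f x xi t * xi ord0 i)%:E = 0)%E].

(* The equation d_t f + xi . grad_x f = I(f, x, xi, t) on t >= 0, read along
   the characteristics; values of f at t < 0 play no role. *)
Definition kinetic_solution I (f0 : V -> V -> R) f : Prop :=
  forall x xi : V,
  [/\ f x xi 0 = f0 x xi,
      f (x + t *: xi) xi t @[t --> (0 : R)^'+] --> f x xi 0 &
      forall t : R, 0 < t ->
        is_derive t (1 : R) (fun s : R => f (x + s *: xi) xi s)
                      (I f (x + t *: xi) xi t)].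

Definition measurable_phase (g : V -> V -> R -> R) : Prop :=
  measurable_fun [set z : (V * V) * R | 0 <= z.2]
                 (fun z => g z.1.1 z.1.2 z.2).

(* Absolute convergence, over bounded time intervals, of the global mass and
   energy balances of I.  The identities of mesoscopic_interaction are local
   in (x, t); without such a bound energy can escape to infinity in x, and
   mass, momentum and energy need not be invariant. *)
Definition integrable_interaction I f : Prop :=
  forall T : R, 0 <= T ->
  (\int[@lebesgue_measure R]_(t in `[0%R, T])
     \int[(lambda \x lambda)%E]_z
       (`|I f z.1 z.2 t| * (1 + enorm z.2 ^+ 2))%:E < +oo)%E.

Definition moment f (w : V -> V -> R) (t : R) : \bar R :=
  (\int[(lambda \x lambda)%E]_z (f z.1 z.2 t * w z.1 z.2)%:E)%E.

Definition mass f := moment f (fun _ _ => 1).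
Definition energy f := moment f (fun _ xi => enorm xi ^+ 2).
Definition momentum f (i : 'I_n) := moment f (fun _ xi => xi ord0 i).
Definition angular_momentum f := moment f (fun x xi => dotv x xi).
Definition uncertainty f := moment f (fun x xi => enorm x * enorm xi).

Definition relative_angular_norm f : \bar R :=
  ereal_sup [set (uncertainty f t - angular_momentum f t)%E
            | t in [set t : R | 0 <= t]].

End kinetic.

(* Main.v *)
From HB Require Import structures.
From mathcomp Require Import ring lra measurable_realfun.
Require Import Defs.

Set Implicit Arguments.
Unset Strict Implicit.
Unset Printing Implicit Defensive.

(**
In the free coordinates [y = x - t xi] the function
[|y|^2 - y . xi + |xi|^2] is constant along characteristics and is a polynomial
of degree two in [xi] at each fixed [(x, t)], so its integral against [f] is
conserved by a mesoscopic interaction.  Pointwise it dominates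
[|x||xi| - x . xi], which gives the bound on the relative angular norm, and
[|x||xi|] plus it dominates [t |xi|^2], so that [U(t) >= t E - const].

This function is not integrable against the interaction, hence it is replaced
by a regularization depending on [e > 0] that is bounded by a multiple of
[1 + |xi|^2]; the error is controlled by dominated convergence and the limit
[e -> 0] is taken with Fatou's lemma.  Along a characteristic the equation only
says that [f] is differentiable with integrable derivative, so the fundamental
theorem of calculus is needed in the form: an everywhere derivative dominating
an integrable [h] has increments at least [\int h].
*)

(** * Increments of everywhere differentiable functions *)

(** The interaction is summable only against [1 + |xi|^2], whereas the conserved quantity, written
    in [x] as [|x|^2 - (2 t + 1) x . xi + (t^2 + t + 1) |xi|^2], is quadratic in the position. The
    price of regularizing is that [virial e] drifts along trajectories. Its rate is at most [weight]
    times [virial_defect], a factor that depends on the trajectory but not on the time, is bounded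
    uniformly in [e] and vanishes pointwise as [e] tends to 0; a majorant of [f * weight] over the
    whole time interval then makes the accumulated drift disappear. All estimates are one-sided: an
    upper bound for the virial moment suffices, and of the energy only [E(0) <= E(t)] is used. The
    divergence of [U] requires [E > 0]; this is drawn from positive mass, since velocities with
    vanishing first coordinate form a null set. Some such positivity is unavoidable, as [f = 0] has
    [U = 0]. *)

Section increments.
Context {R : realType}.
Implicit Types (F G h : R -> R) (a b : R).
Local Notation mu := (@lebesgue_measure R).

(** [S] collects the points where [G] is not below [G a]. The left condition keeps [sup S] in [S],
    and the right condition moves past any supremum smaller than [b]. Upward jumps are compatible
    with both conditions, so a monotone summand may be added to [G] without continuity. *)
Lemma right_increasing_le G a b : a <= b ->
  (forall x, a <= x < b -> \forall y \near x^'+, G x <= G y) ->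
  (forall x e, a < x <= b -> 0 < e -> \forall y \near x^'-, G y <= G x + e) ->
  G a <= G b.
Proof.
move=> ab Gr Gl.
pose S := [set x | a <= x <= b /\ G a <= G x].
have Sa : S a by split; rewrite ?lexx.
have supS : has_sup S by split; [exists a | exists b => x [/andP[]]].
set c := sup S.
have ac : a <= c by apply: ub_le_sup => //; exact: supS.2.
have cb : c <= b by apply: ge_sup; [exists a | move=> x [/andP[]]].
have Sc : S c.
  split; first exact/andP.
  move: ac; rewrite le_eqVlt => /predU1P[<-//|ac].
  apply/ler_addgt0Pr => e e0.
  have [d /= d0 dG] := Gl c e (introT andP (conj ac cb)) e0.
  have [x Sx cx] := sup_adherent d0 supS.
  have xc : x <= c by apply: ub_le_sup => //; exact: supS.2.
  apply: (le_trans Sx.2); move: xc; rewrite le_eqVlt => /predU1P[->|xc].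
    by rewrite lerDl ltW.
  apply: dG => //=; rewrite ger0_norm ?subr_ge0 ?(ltW xc)//.
  by rewrite ltrBlDr -ltrBlDl.
move: (cb); rewrite le_eqVlt => /predU1P[<-|cb']; first exact: Sc.2.
have := Gr c; rewrite ac cb' => /(_ isT) Gc.
have [y [cy Sy]] : exists y, c < y /\ S y.
  apply: (@filter_ex _ (c^'+)); near=> y; split; first by near: y; exact: nbhs_right_gt.
  split; last by apply: (le_trans Sc.2); near: y.
  apply/andP; split; first by apply: (le_trans ac); exact: ltW.
  by near: y; exact: nbhs_right_le.
have : y <= c by apply: ub_le_sup => //; exact: supS.2.
by rewrite leNgt cy.
Unshelve. all: by end_near. Qed.

(* The sum of the Lebesgue measures of open sets [U n] of measure less than
   [e / 2 ^ n.+1] that contain the null set has infinite derivative on it. *)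
Lemma negligible_steep_measure (N : set R) (e : R) : 0 < e ->
  mu.-negligible N ->
  exists nu : {measure set (measurableTypeR R) -> \bar R}, (nu setT <= e%:E)%E /\
    forall x (K : R), N x ->
      \forall y \near x^'+, ((K * (y - x))%:E <= nu [set` `]x, y]])%E.
Proof.
move=> e0 [A [mA A0 NA]].
have U_ n : {U : set R | [/\ open U, A `<=` U & (mu U < (e / (2 ^ n.+1)%:R)%:E)%E]}.
  apply/cid; have := @lebesgue_regularity_outer _ A _ mA.
  rewrite [X in (X < +oo)%E]A0 => /(_ (e / (2 ^ n.+1)%:R) (ltry _)) [|U [oU AU]].
    by rewrite divr_gt0// ltr0n expn_gt0.
  move=> UA; exists U; split => //.
  rewrite -(setDKU AU).
  have mUA : measurable (U `\` A).
    by apply: measurableD => //; exact: open_measurable.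
  apply: le_lt_trans; first exact: measureU2.
  by rewrite [X in (_ + X)%E]A0 adde0.
pose U n := sval (U_ n).
have oU n : open (U n) by have [] := svalP (U_ n).
have AU n : A `<=` U n by have [] := svalP (U_ n).
have muU n : (mu (U n) < (e / (2 ^ n.+1)%:R)%:E)%E by have [] := svalP (U_ n).
have mU n : measurable (U n) by exact: open_measurable.
pose nu := mseries (fun n => mrestr mu (mU n)) 0.
exists nu; split.
  rewrite /nu/= /mseries/=.
  apply: le_trans (epsilon_trick0 xpredT (ltW e0)).
  apply: lee_nneseries => [n _ _|n _]; first exact: measure_ge0.
  by rewrite /mrestr (@setTI R (U n)); exact/ltW/muU.
move=> x K Nx.
(* The first [M >= K] open sets all contain []x, y]] once [y] is close to [x], and each contributes
   [y - x] to [nu]. *)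
have [M KM] : exists M : nat, K <= M%:R by exists (Num.truncn K).+1; rewrite ltW// truncnS_gt.
have xU n : \forall y \near x^'+, [set` `]x, y]] `<=` U n.
  have /nbhs_ballP[d /= d0 dU] : nbhs x (U n) by apply: open_nbhs_nbhs; split => //; exact/AU/NA.
  near=> y => z /=; rewrite in_itv/= => /andP[xz zy]; apply: dU.
  rewrite /ball/= ltr0_norm ?subr_lt0// opprB ltrBlDl (le_lt_trans zy)//.
  by near: y; apply: nbhs_right_lt; rewrite ltrDl.
have {}xU : \forall y \near x^'+, forall n, (n < M)%N -> [set` `]x, y]] `<=` U n.
  elim: {KM} M => [|M IH]; first by near=> y.
  near=> y => n; rewrite ltnS leq_eqVlt => /predU1P[->|nM].
    by near: y; exact: xU.
  by move: n nM; near: y.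
near=> y.
have xy : x < y by near: y; exact: nbhs_right_gt.
have xyU n : (n < M)%N -> [set` `]x, y]] `<=` U n by move: n; near: y.
apply: (@le_trans _ _ (M%:R * (y - x))%:E).
  by rewrite lee_fin ler_wpM2r// subr_ge0 ltW.
rewrite /nu/= /mseries/=.
apply: (@le_trans _ _ (\sum_(0 <= n < M) mrestr mu (mU n) [set` `]x, y]])%E); last first.
  apply: nneseries_lim_ge => n _ _; exact: measure_ge0.
rewrite (eq_big_nat _ _ (F2 := fun=> (y - x)%:E)); last first.
  move=> n /andP[_ nM]; rewrite /mrestr (setIidl (xyU _ nM)).
  by rewrite lebesgue_measure_itv/= lte_fin xy EFinB.
by rewrite sumEFin lee_fin big_const_nat subn0 iter_addr_0 mulr_natl.
Unshelve. all: by end_near. Qed.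
End increments.

(** * Comparing the increments of a function with the integral of a minorant of its derivative *)

Section increment_bound.
Context {R : realType}.
Implicit Types (F G h : R -> R) (a b : R).
Local Notation mu := (@lebesgue_measure R).

Lemma derive_right_increment F (x d k : R) : is_derive x (1 : R) F d -> k < d ->
  \forall y \near x^'+, k * (y - x) <= F y - F x.
Proof.
move=> [/cvg_ex[/= l Fl] dF] kd.
have {dF} : l = d by rewrite -dF; apply/esym/cvg_lim.
move=> ld; move: Fl; rewrite {l}ld => Fd.
have /= := cvgr_gt _ Fd _ kd.
case=> e /= e0 H.
near=> y.
have xy : x < y by near: y; exact: nbhs_right_gt.
have : k < (y - x)^-1 *: (F ((y - x) *: (1 : R) + x) - F x).
  apply: H => /=; last by rewrite subr_eq0 gt_eqF.
  rewrite /ball/= sub0r normrN ger0_norm ?subr_ge0 ?ltW// ltrBlDl.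
  by near: y; apply: nbhs_right_lt; rewrite ltrDl.
rewrite [_ *: 1]mulr1 subrK => /ltW; rewrite [_ *: _]mulrC ler_pdivlMr ?subr_gt0//.
Unshelve. all: by end_near. Qed.

Lemma Rintegral_itv_cat h a x y : mu.-integrable setT (EFin \o h) ->
  a <= x -> x <= y ->
  (\int[mu]_(t in `[a, y]) h t - \int[mu]_(t in `[a, x]) h t
   = \int[mu]_(t in `]x, y]) h t)%R.
Proof.
move=> ih ax xy; rewrite (@Rintegral_itvB _ _ (BLeft a) (BRight y) x) ?bnd_simp//.
by apply: (integrableS measurableT).
Qed.

(* [h] is bounded above, so [F - \int h] cannot decrease fast at the points of
   the null set where Lebesgue differentiation fails; the slope is repaired
   there by the steep measure. *)
Lemma integral_bounded_le_increment F (dF : R -> R) h a b k : a < b ->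
  F y @[y --> a^'+] --> F a ->
  (forall x, a < x <= b -> is_derive x (1 : R) F (dF x)) ->
  (forall x, a < x <= b -> h x <= dF x) ->
  (forall x, h x <= k) ->
  mu.-integrable setT (EFin \o h) ->
  (\int[mu]_(t in `[a, b]) h t)%R <= F b - F a.
Proof.
move=> ab Fa dFx hdF hk ih.
pose H x := (\int[mu]_(t in `[a, x]) h t)%R.
have ihS A : measurable A -> mu.-integrable A (EFin \o h).
  by move=> mA; exact: (integrableS measurableT).
have lh : locally_integrable setT h.
  by apply: open_integrable_locally => //; exact: openT.
have /= aeH := @FTC1 R h (BLeft a) (fun y => ihS _ (measurable_itv _)) lh.
have cH := @parameterized_integral_continuous R a (b + 1) h
  (ltW (ltr_pwDr ltr01 (ltW ab))) (ihS _ (measurable_itv _)).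
have /(continuous_within_itvP _ (ltr_pwDr ltr01 (ltW ab)))[cHi cHa _] := cH.
have Haa : H a = 0 by rewrite /H set_itv1 Rintegral_set1.
have hH x y : a <= x -> x <= y -> H y - H x <= k * (y - x).
  move=> ax xy; rewrite /H Rintegral_itv_cat//.
  have -> : k * (y - x) = (\int[mu]_(t in `]x, y]) k)%R.
    rewrite Rintegral_cst ?measurable_itv//= lebesgue_measure_itv/= lte_fin.
    by move: xy; rewrite le_eqVlt => /predU1P[->|->]; rewrite ?ltxx ?subrr.
  apply: le_Rintegral => //; first exact: ihS.
  apply/integrableP; split; first exact/measurable_EFinP/measurable_cst.
  rewrite integral_cst; last exact: measurable_itv.
  by rewrite /= lebesgue_measure_itv/=; case: ifP => _; rewrite ?mule0 ?ltry// -EFinB -EFinM ltry.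
apply/ler_addgt0Pr => e0 e00.
(* The error [e0] is spent as [e * (b - a)] on the linear term of [G], [e] on the mass of [nu], and
   [e] on moving the left end off [a]. *)
pose e := e0 / (b - a + 2).
have ba0 : 0 < b - a + 2 by lra.
have e_gt0 : 0 < e by rewrite divr_gt0.
have [nu [nuT nuN]] := negligible_steep_measure e_gt0 aeH.
have nufin A : measurable A -> nu A \is a fin_num.
  move=> mA; rewrite ge0_fin_numE//; apply: le_lt_trans (ltry e).
  by apply: le_trans nuT; apply: le_measure; rewrite ?inE.
pose B x := fine (nu [set` `]a, x]]).
have BB x y : a <= x -> x <= y -> B y = B x + fine (nu [set` `]x, y]]).
  move=> ax xy; rewrite /B -fineD; last 2 first.
  - apply: nufin; exact: measurable_itv.
  - apply: nufin; exact: measurable_itv.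
  congr fine; rewrite -measureU; [|exact: measurable_itv..|].
    by congr (nu _); rewrite -itv_bndbnd_setU.
  by rewrite -subset0 => z /= []; rewrite !in_itv/= => /andP[_ zx] /andP[/lt_geF]; rewrite zx.
have Bmono x y : a <= x -> x <= y -> B x <= B y.
  by move=> ax xy; rewrite (BB _ _ ax xy) lerDl fine_ge0.
(* Where [H] has derivative [h], the term [e * x] turns the weak inequality [h <= dF] into a strict
   slope; on the remaining null set the slope comes from [B]. *)
pose G x := F x - H x + B x + e * x.
have dFc x : a < x <= b -> {for x, continuous F}.
  move=> xab; apply: differentiable_continuous; apply/derivable1_diffP.
  by have [] := dFx _ xab.
have Gab c : a < c < b -> G c <= G b.
  move=> /andP[ac cb].
  apply: right_increasing_le (ltW cb) _ _ => [x /andP[cx xb]|x e1 /andP[cx xb] e10].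
    have ax : a < x by exact: lt_le_trans cx.
    have xab : a < x <= b by rewrite ax ltW.
    have [Hx|Hx] := pselect (derivable H x 1 /\ derive1 H x = h x).
      have dHx : is_derive x (1 : R) H (h x).
        by case: Hx => dH <-; rewrite derive1E; exact: derivableP.
      have dFH : is_derive x (1 : R) (F - H) (dF x - h x) by exact: is_deriveB (dFx _ xab) dHx.
      have := derive_right_increment dFH (_ : - e < _).
      have -> : - e < dF x - h x by have := hdF _ xab; lra.
      move=> /(_ isT) inc; near=> y.
      have xy : x < y by near: y; exact: nbhs_right_gt.
      have : - e * (y - x) <= (F - H) y - (F - H) x by near: y.
      have := Bmono _ _ (ltW ax) (ltW xy).
      rewrite /G /= -![(F - H) _]/(F _ - H _); lra.
    have nHx : ~ (a < x -> derivable H x 1 /\ derive1 H x = h x).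
      by move=> /(_ ax).
    (* To the right of [x], [F] has slope at least [dF x - 1] and [H] has slope at most [k]; [nu]
       supplies the difference. *)
    have nux := nuN x (k + 1 - dF x) nHx.
    have := derive_right_increment (dFx _ xab) (_ : dF x - 1 < _).
    rewrite ltrBlDr ltrDl ltr01 => /(_ isT) inc.
    near=> y.
    have xy : x < y by near: y; exact: nbhs_right_gt.
    have Fy : (dF x - 1) * (y - x) <= F y - F x by near: y.
    have Hy := hH _ _ (ltW ax) (ltW xy).
    have : (((k + 1 - dF x) * (y - x))%:E <= nu [set` `]x, y]])%E by near: y.
    rewrite -[X in (_ <= X)%E -> _]fineK; last (apply: nufin; exact: measurable_itv).
    rewrite lee_fin => nuxy.
    have exy : 0 <= e * (y - x) by apply: mulr_ge0; rewrite ?subr_ge0 ltW.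
    rewrite /G (BB _ _ (ltW ax) (ltW xy)); lra.
  have ax : a < x by exact: lt_trans cx.
  have xab : a < x <= b by rewrite ax.
  have cFH : {for x, continuous (fun y => F y - H y + e * y)}.
    apply: cvgD; first apply: cvgB.
    - exact: dFc.
    - apply: cHi; rewrite in_itv/= ax/=; lra.
    - by apply: cvgM; [exact: cvg_cst | exact: cvg_id].
  have : \forall y \near x^'-, F y - H y + e * y < F x - H x + e * x + e1.
    have := cvgr_lt _ (cvg_at_left_filter cFH) (F x - H x + e * x + e1).
    by apply; rewrite ltrDl.
  move=> FHl; near=> y.
  have yx : y < x by near: y; exact: nbhs_left_lt.
  have ay : a < y by near: y; exact: nbhs_left_gt.
  have := Bmono _ _ (ltW ay) (ltW yx).
  have : F y - H y + e * y < F x - H x + e * x + e1 by near: y.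
  rewrite /G; lra.
have Bb : B b <= e.
  rewrite -lee_fin fineK; last (apply: nufin; exact: measurable_itv).
  by apply: le_trans nuT; apply: le_measure; rewrite ?inE//; exact: measurable_itv.
have FHa : (F y - H y) @[y --> a^'+] --> F a - 0 by apply: cvgB => //; rewrite -Haa.
(* At [a] only right continuity of [F] is known, so the monotonicity of [G] is used from a point
   [c > a] at which [F - H] has lost less than [e]. *)
have [c [cFH acb]] : exists c, F a - e < F c - H c /\ a < c < b.
  apply: (@filter_ex _ (a^'+)); near=> c; split.
    by near: c; apply: (cvgr_gt _ FHa); rewrite subr0 ltrBlDr ltrDl.
  apply/andP; split; near: c; [exact: nbhs_right_gt | exact: nbhs_right_lt].
have := Gab _ acb; rewrite /G.
have B0 : 0 <= B c by rewrite /B fine_ge0.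
have -> : e0 = e * (b - a + 2) by rewrite /e divfK// gt_eqF.
have : e * a <= e * c by rewrite ler_pM2l//; case/andP: acb => /ltW.
rewrite -/(H b); lra.
Unshelve. all: by end_near. Qed.
End increment_bound.

(** Truncating [h] from above at [n] gives the bounded case: the truncation stays below [dF] and, as
    [n] is nonnegative, is dominated by [|h|], so the integrals converge. *)
Lemma integral_le_increment {R : realType} (F dF h : R -> R) (a b : R) : a < b ->
  F y @[y --> a^'+] --> F a ->
  (forall x, a < x <= b -> is_derive x (1 : R) F (dF x)) ->
  (forall x, a < x <= b -> h x <= dF x) ->
  (@lebesgue_measure R).-integrable `[a, b] (EFin \o h) ->
  (\int[@lebesgue_measure R]_(t in `[a, b]) (h t)%:E <= (F b - F a)%:E)%E.
Proof.
move=> ab Fa dFx hdF ih.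
set mu := @lebesgue_measure R.
set D := [set` `[a, b]] : set R.
have mD : measurable D by exact: measurable_itv.
have mh : measurable_fun D h by apply/measurable_EFinP; exact: (measurable_int mu).
pose hn n x := Num.min (h x) n%:R.
have mhn n : measurable_fun D (hn n) by apply: measurable_minr => //; exact: measurable_cst.
have hnh n x : (`|(hn n x)%:E| <= `|h x|%:E)%E.
  rewrite abse_EFin lee_fin /hn minEle; case: ifPn => //; rewrite -ltNge => nh.
  by rewrite normr_nat (le_trans (ltW nh))// ler_norm.
have ihn n : mu.-integrable D (EFin \o hn n).
  apply: le_integrable ih => //; first by apply/measurable_EFinP; exact: mhn.
  by move=> x _ /=; exact: hnh.
have bnd n : (\int[mu]_(t in D) (hn n t)%:E <= (F b - F a)%:E)%E.
  rewrite -[leLHS]fineK; last exact: integrable_fin_num (ihn n).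
  rewrite lee_fin.
  have := @integral_bounded_le_increment R F dF (hn n \_ D) a b n%:R ab Fa dFx.
  rewrite -/D -/mu (_ : \int[mu]_(t in D) (hn n \_ D) t = \int[mu]_(t in D) hn n t).
    apply.
    - move=> x xab; rewrite patchE mem_set; last first.
        by rewrite /D/= in_itv/=; case/andP: xab => /ltW-> ->.
      by apply: le_trans (hdF _ xab); rewrite /hn ge_min lexx.
    - move=> x; rewrite patchE; case: ifP => _; last exact: ler0n.
      by rewrite /hn ge_min lexx orbT.
    - by have := (@integrable_mkcond _ _ _ mu D (EFin \o hn n) mD).1 (ihn n); rewrite restrict_EFin.
  by apply: eq_Rintegral => x xD; rewrite patchE xD.
have [_ _ cv] : [/\ mu.-integrable D (EFin \o h),
    [sequence \int[mu]_(x in D) `|(hn n x)%:E - (h x)%:E|]_n @ \oo --> 0 &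
    [sequence \int[mu]_(x in D) (hn n x)%:E]_n @ \oo --> \int[mu]_(x in D) (h x)%:E]%E.
  apply: (@dominated_convergence _ _ _ mu _ mD (fun n => EFin \o hn n) (EFin \o h) (EFin \o (fun x => `|h x|))).
  - by move=> n; apply/measurable_EFinP; exact: mhn.
  - by apply/measurable_EFinP.
  - apply: aeW => x _ /=; apply: cvg_near_cst.
    near=> n; rewrite /hn min_l//.
    by near: n; exact: nbhs_infty_ger.
  - by have := integrable_abse ih.
  - by apply: aeW => x n _ /=; exact: hnh.
rewrite -(cvg_lim _ cv)//; apply: lime_le; first by apply/cvg_ex; eexists; exact: cv.
by apply: nearW => n; exact: bnd.
Unshelve. all: by end_near. Qed.

(** * Invariance of Lebesgue measure under free transport *)

Section translation.
Context {R : realType}.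

(** The image of Lebesgue measure under the shift gives every interval []a, b]] its length, and
    these values determine the measure. *)
Lemma ge0_integral_lebesgue_shift (f : measurableTypeR R -> \bar R) (c : R) :
  measurable_fun setT f -> (forall x, 0 <= f x)%E ->
  (\int[@lebesgue_measure R]_x f (x + c)%R = \int[@lebesgue_measure R]_x f x)%E.
Proof.
move=> mf f0; pose s := (fun x => x + c) : R -> measurableTypeR R.
have ms : measurable_fun setT (s : measurableTypeR R -> measurableTypeR R).
  by apply: measurable_funD => //; exact: measurable_cst.
have := @ge0_integral_pushforward _ _ (measurableTypeR R) (measurableTypeR R) R s ms (@lebesgue_measure R) setT f measurableT mf.
rewrite preimage_setT => <-; last by move=> y _.
apply: eq_measure_integral => A mA _.
apply/esym/(@lebesgue_measure_unique R (pushforward (@lebesgue_measure R) s)) => //= _ [[a b]] _ <-.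
rewrite /pushforward (_ : s @^-1` _ = `]a - c, b - c]%classic); last first.
  by apply/seteqP; split => x /=; rewrite /s !in_itv/= ltrBlDr lerBrDr.
by rewrite !lebesgue_measure_itv/= !lte_fin ltrD2r -!EFinB (_ : b - c - (a - c) = b - a)//; ring.
Qed.

Lemma ge0_integral_rV_cons n (f : 'rV[R]_n.+1 -> \bar R) :
  measurable_fun setT f -> (forall x, 0 <= f x)%E ->
  (\int[lebesgue_rV R n.+1]_x f x =
   \int[(@lebesgue_measure R \x lebesgue_rV R n)%E]_x f (rV_cons x))%E.
Proof.
move=> mf f0.
have := @ge0_integral_pushforward _ _ _ _ R (@rV_cons R n)
  (measurable_rV_cons (n:=n)) (@lebesgue_measure R \x lebesgue_rV R n)%E setT f measurableT mf.
by rewrite preimage_setT; apply => y _.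
Qed.

Lemma measurable_rVD n (v : 'rV[R]_n) :
  measurable_fun setT (fun x : 'rV[R]_n => x + v).
Proof.
apply: measurable_rVP => i; under eq_fun do rewrite mxE.
by apply: measurable_funD; [exact: measurable_coord | exact: measurable_cst].
Qed.

(** Tonelli on the splitting of the first coordinate: the tail is shifted by the induction
    hypothesis, the head by the one-dimensional case. *)
Lemma ge0_integral_lebesgue_rV_shift n (f : 'rV[R]_n -> \bar R) (v : 'rV[R]_n) :
  measurable_fun setT f -> (forall x, 0 <= f x)%E ->
  (\int[lebesgue_rV R n]_x f (x + v)%R = \int[lebesgue_rV R n]_x f x)%E.
Proof.
elim: n f v => [|n IH] f v mf f0.
  by apply: eq_integral => x _; congr f; apply/rowP => -[].
have mfc : measurable_fun setT (f \o @rV_cons R n).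
  by apply: measurableT_comp => //; exact: measurable_rV_cons.
have mfv : measurable_fun setT (fun x : 'rV[R]_n.+1 => f (x + v)).
  by apply: measurableT_comp => //; exact: measurable_rVD.
rewrite !ge0_integral_rV_cons//.
pose v' : 'rV[R]_n := \row_i v ord0 (lift ord0 i).
have consD p : rV_cons p + v = rV_cons (p.1 + v ord0 ord0, p.2 + v').
  apply/rowP => i; rewrite !mxE; case: unliftP => [j ->|->] //=.
  by rewrite !mxE.
under eq_integral do rewrite consD.
have mcv : measurable_fun setT
    (fun p : measurableTypeR R * 'rV[R]_n => f (rV_cons (p.1 + v ord0 ord0, p.2 + v'))).
  under eq_fun do rewrite -consD.
  by apply: (measurableT_comp mfv); exact: measurable_rV_cons.
rewrite !fubini_tonelli1//= /fubini_F/=.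
pose Phi (a : measurableTypeR R) := (\int[lebesgue_rV R n]_w f (rV_cons (a, w)))%E.
transitivity (\int[@lebesgue_measure R]_a Phi (a + v ord0 ord0)%R)%E.
  apply: eq_integral => a _.
  apply: (IH (fun w => f (rV_cons ((a : R) + v ord0 ord0, w)))) => //.
  exact: (measurableT_comp mfc (pair1_measurable (_ : measurableTypeR R))).
apply: (@ge0_integral_lebesgue_shift Phi).
  by apply: (measurable_fun_fubini_tonelli_F _ mfc) => p; exact: f0.
by move=> a; apply: integral_ge0 => w _; exact: f0.
Qed.
End translation.

(** * Phase space and the shear that transports it freely *)

Section phase_measure.
Context {R : realType} (n : nat).
Local Notation V := 'rV[R]_n.
Local Notation lambda := (lebesgue_rV R n).

(* A named copy of the product measure, to which sigma-finiteness is attached: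
   the library's instance for products is not found by inference. *)
Definition phase_measure : set (V * V) -> \bar R := (lambda \x lambda)%E.

HB.instance Definition _ := Measure.on phase_measure.

Let phase_measure_sigma_finite : sigma_finite setT phase_measure.
Proof.
have /sigma_finiteP[F [TF ndF Foo]] := sigma_finiteT lambda.
exists (fun n => F n `*` F n).
  rewrite -setXTT TF predeqE => -[x y]; split.
    move=> [/= [k _ Fkx] [l _ Fly]]; exists (maxn k l) => //; split.
    - by move: x Fkx; exact/subsetPset/ndF/leq_maxl.
    - by move: y Fly; exact/subsetPset/ndF/leq_maxr.
  by move=> [k _ []/= ? ?]; split; exists k.
move=> k; have [? ?] := Foo k; split; first exact: measurableX.
by rewrite /phase_measure product_measure1E// lte_mul_pinfty// ge0_fin_numE.
Qed.

HB.instance Definition _ := @Measure_isSigmaFinite.Build _ _ _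
  phase_measure phase_measure_sigma_finite.

Lemma measurable_shear (t : R) :
  measurable_fun setT (fun z : V * V => (z.1 + t *: z.2, z.2)).
Proof.
apply/measurable_fun_pairP; split; last exact: measurable_snd.
apply: measurable_rVP => i /=; under eq_fun do rewrite !mxE.
apply: measurable_funD.
  exact: (measurableT_comp (measurable_coord i) measurable_fst).
apply: measurable_funM; first exact: measurable_cst.
exact: (measurableT_comp (measurable_coord i) measurable_snd).
Qed.

(** At fixed velocity the shear is a translation in position, hence Tonelli with [xi] as the outer
    variable. *)
Lemma ge0_integral_shear (t : R) (F : V * V -> \bar R) :
  measurable_fun setT F -> (forall z, 0 <= F z)%E ->
  (\int[phase_measure]_z F (z.1 + t *: z.2, z.2)%R = \int[phase_measure]_z F z)%E.
Proof.
move=> mF F0; rewrite /phase_measure.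
have mFs : measurable_fun setT (fun z : V * V => F (z.1 + t *: z.2, z.2)).
  exact: (measurableT_comp mF (measurable_shear t)).
rewrite !fubini_tonelli2//; apply: eq_integral => xi _; rewrite /fubini_G/=.
apply: (@ge0_integral_lebesgue_rV_shift _ _ (fun y => F (y, xi))) => //.
exact: (measurableT_comp mF (pair2_measurable _)).
Qed.
End phase_measure.

(** * Euclidean structure *)

Section euclidean.
Context {R : realType} {n : nat}.
Local Notation V := 'rV[R]_n.
Implicit Types x y z : V.

Lemma dotvC x y : dotv x y = dotv y x.
Proof. by apply: eq_bigr => i _; rewrite mulrC. Qed.

Lemma dotvDl x y z : dotv (x + y) z = dotv x z + dotv y z.
Proof. by rewrite /dotv -big_split/=; apply: eq_bigr => i _; rewrite mxE mulrDl. Qed.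

Lemma dotvZl (c : R) x y : dotv (c *: x) y = c * dotv x y.
Proof. by rewrite /dotv big_distrr/=; apply: eq_bigr => i _; rewrite mxE mulrA. Qed.

Lemma dotvDr x y z : dotv x (y + z) = dotv x y + dotv x z.
Proof. by rewrite dotvC dotvDl !(dotvC x). Qed.

Lemma dotvZr (c : R) x y : dotv x (c *: y) = c * dotv x y.
Proof. by rewrite dotvC dotvZl dotvC. Qed.

Lemma dotvNl x y : dotv (- x) y = - dotv x y.
Proof. by rewrite -scaleN1r dotvZl mulN1r. Qed.

Lemma dotvNr x y : dotv x (- y) = - dotv x y.
Proof. by rewrite dotvC dotvNl dotvC. Qed.

Lemma dotv_ge0 x : 0 <= dotv x x.
Proof. by apply: sumr_ge0 => i _; rewrite -expr2 sqr_ge0. Qed.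

Lemma dotv_eq0 x : dotv x x = 0 -> forall i, x ord0 i = 0.
Proof.
move=> xx0 i; have sq_ge0 (j : 'I_n) : true -> 0 <= x ord0 j * x ord0 j.
  by rewrite -expr2 sqr_ge0.
by have /eqP := psumr_eq0P sq_ge0 xx0 (i := i) isT; rewrite mulf_eq0 orbb => /eqP.
Qed.

Lemma sqr_enorm x : enorm x ^+ 2 = dotv x x.
Proof. by rewrite sqr_sqrtr ?dotv_ge0. Qed.

Lemma enorm_ge0 x : 0 <= enorm x.
Proof. exact: sqrtr_ge0. Qed.

Lemma sqr_dotv_le x y : dotv x y ^+ 2 <= dotv x x * dotv y y.
Proof.
have [xx0|xx0] := eqVneq (dotv x x) 0.
  suff -> : dotv x y = 0 by rewrite xx0 mul0r expr0n.
  by apply: big1 => i _; rewrite (dotv_eq0 xx0) mul0r.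
have xx_gt0 : 0 < dotv x x by rewrite lt_def xx0 dotv_ge0.
(* This square is [dotv x x] times the difference of the two sides of the inequality. *)
have := dotv_ge0 (dotv x x *: y - dotv x y *: x).
rewrite -scaleNr !(dotvDl, dotvDr, dotvZl, dotvZr) (dotvC y x).
move=> yx; rewrite -subr_ge0 -(pmulr_rge0 _ xx_gt0); apply: (le_trans yx).
by rewrite le_eqVlt; apply/orP; left; apply/eqP; ring.
Qed.

Lemma dotv_le_enorm x y : `|dotv x y| <= enorm x * enorm y.
Proof.
by rewrite -ler_sqr ?nnegrE ?mulr_ge0 ?enorm_ge0// exprMn !sqr_enorm real_normK ?num_real ?sqr_dotv_le.
Qed.

Lemma enormD_le x y : enorm (x + y) <= enorm x + enorm y.
Proof.
rewrite -ler_sqr ?nnegrE ?addr_ge0 ?enorm_ge0// sqrrD !sqr_enorm dotvDl !dotvDr (dotvC y x).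
have := le_trans (ler_norm _) (dotv_le_enorm x y); lra.
Qed.

Lemma enormZ (c : R) x : enorm (c *: x) = `|c| * enorm x.
Proof. by rewrite /enorm dotvZl dotvZr mulrA -expr2 sqrtrM ?sqr_ge0// sqrtr_sqr. Qed.

Lemma measurable_dotv d (T : measurableType d) (D : set T) (a b : T -> V) :
  measurable_fun D a -> measurable_fun D b ->
  measurable_fun D (fun w => dotv (a w) (b w)).
Proof.
move=> ma mb; apply: measurable_sum => i.
apply: measurable_funM.
  exact: (measurableT_comp (measurable_coord i) ma).
exact: (measurableT_comp (measurable_coord i) mb).
Qed.

Lemma measurable_enorm d (T : measurableType d) (D : set T) (a : T -> V) :
  measurable_fun D a -> measurable_fun D (fun w => enorm (a w)).
Proof.
move=> ma; have msq : measurable_fun setT (@Num.sqrt R).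
  apply: continuous_measurable_fun; exact: sqrt_continuous.
exact: (measurableT_comp msq (measurable_dotv ma ma)).
Qed.
End euclidean.

(** * Time and phase space together *)

Section time_phase.
Context {R : realType} {n : nat}.
Local Notation V := 'rV[R]_n.

(** Joint measurability is known only for nonnegative times; extension by zero outside [[0, T]]
    makes Fubini available on the whole product space. *)
Definition time_cut (T : R) (H : V -> V -> R -> R)
    (p : measurableTypeR R * (V * V)) : R :=
  if 0 <= p.1 <= T then H p.2.1 p.2.2 p.1 else 0.

(** Passage from free coordinates to phase coordinates: the argument carries the starting point of a
    trajectory, the value carries the position at the given time. *)
Definition flow (p : measurableTypeR R * (V * V)) : measurableTypeR R * (V * V) :=
  (p.1, (p.2.1 + (p.1 : R) *: p.2.2, p.2.2)).

Lemma measurable_time_cut T H : measurable_phase H ->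
  measurable_fun setT (time_cut T H).
Proof.
move=> mH.
have mswap : measurable_fun setT (fun p : measurableTypeR R * (V * V) => (p.2, (p.1 : R))).
  apply/measurable_fun_pairP; split; [exact: measurable_snd | exact: measurable_fst].
pose D := [set z : (V * V) * R | 0 <= z.2].
have mD : measurable D.
  rewrite (_ : D = snd @^-1` `[0, +oo[%classic); last first.
    by apply/seteqP; split => z; rewrite /D/= in_itv/= andbT.
  rewrite -[X in measurable X]setTI; apply: measurable_snd => //; exact: measurable_itv.
have mHD := (measurable_restrictT _ mD).1 mH.
have -> : time_cut T H = (fun p => if p.1 \in `[0, T] then
    ((fun z : (V * V) * R => H z.1.1 z.1.2 z.2) \_ D) (p.2, (p.1 : R)) else 0).
  apply/funext => p; rewrite /time_cut in_itv/=; case: ifP => // /andP[p0 _].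
  by rewrite patchE mem_set.
apply: measurable_fun_ifT => //; last exact: (measurableT_comp mHD mswap).
apply: (measurable_fun_bool true).
rewrite [X in measurable X](_ : _ = setT `&` fst @^-1` [set` `[0, T]]).
  by apply: measurable_fst => //; exact: measurable_itv.
by [].
Qed.

Lemma measurable_flow : measurable_fun setT flow.
Proof.
apply/measurable_fun_pairP; split; first exact: measurable_fst.
apply/measurable_fun_pairP; split; last exact: (measurableT_comp measurable_snd measurable_snd).
apply: measurable_rVP => i /=; under eq_fun do rewrite !mxE.
apply: measurable_funD.
  exact: (measurableT_comp (measurable_coord i) (measurableT_comp measurable_fst measurable_snd)).
apply: measurable_funM; first exact: measurable_fst.
exact: (measurableT_comp (measurable_coord i) (measurableT_comp measurable_snd measurable_snd)).
Qed.
End time_phase.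

(** * Balance laws along trajectories *)

Section integration_along_flow.
Context {R : realType} {n : nat}.
Local Notation V := 'rV[R]_n.
Local Notation lambda := (lebesgue_rV R n).
Local Notation mu := (@lebesgue_measure R).
Local Notation m := (@phase_measure R n).
Local Notation TP := (measurableTypeR R * (V * V))%type.

Lemma ge0_integral_flow (K : TP -> \bar R) :
  measurable_fun setT K -> (forall p, 0 <= K p)%E ->
  (\int[mu \x m]_p K (flow p) = \int[mu \x m]_p K p)%E.
Proof.
move=> mK K0.
rewrite !fubini_tonelli1//; last exact: (measurableT_comp mK measurable_flow).
apply: eq_integral => s _; rewrite /fubini_F/=.
apply: (@ge0_integral_shear _ _ s (fun z => K (s, z))) => //.
exact: (measurableT_comp mK (pair1_measurable _)).
Qed.

Lemma integral_flow (K : TP -> \bar R) : measurable_fun setT K ->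
  (\int[mu \x m]_p K (flow p) = \int[mu \x m]_p K p)%E.
Proof.
move=> mK; rewrite [LHS]integralE [RHS]integralE; congr (_ - _)%E.
  rewrite -(ge0_integral_flow (measurable_funepos mK) (funepos_ge0 K)).
  by apply: eq_integral => p _; rewrite !funeposE.
rewrite -(ge0_integral_flow (measurable_funeneg mK) (funeneg_ge0 K)).
by apply: eq_integral => p _; rewrite !funenegE.
Qed.

Lemma integrable_flow (K : TP -> \bar R) :
  (mu \x m)%E.-integrable setT K -> (mu \x m)%E.-integrable setT (K \o flow).
Proof.
move=> /integrableP[mK iK]; apply/integrableP; split.
  exact: (measurableT_comp mK measurable_flow).
by rewrite (ge0_integral_flow (K := fun p => `|K p|%E))//; exact: measurableT_comp.
Qed.

(* The balance laws hold position by position: the integrals over [xi] vanish. *)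
Lemma integral_time_phase_eq0 (K : TP -> \bar R) :
  (mu \x m)%E.-integrable setT K ->
  (forall s x, \int[lambda]_xi K (s, (x, xi)) = 0)%E ->
  (\int[mu \x m]_p K p = 0)%E.
Proof.
move=> iK K0; rewrite -integral12_prod_meas1//.
transitivity (\int[mu]_s cst 0 s)%E; last by rewrite integral0.
apply: ae_eq_integral => //.
- exact: (measurable_int mu (integrable_fubini_F iK)).
- have := ae_integrable1 iK; apply: filterS => s iKs _.
  rewrite /fubini_F -(integral12_prod_meas1 iKs) /=.
  by apply: integral0_eq => x _; exact: K0.
Qed.

End integration_along_flow.

(** * Cancellation of the interaction against quadratic polynomials in the velocity *)

Section interaction.
Context {R : realType} {n : nat}.
Local Notation V := 'rV[R]_n.
Local Notation lambda := (lebesgue_rV R n).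
Local Notation mu := (@lebesgue_measure R).
Local Notation m := (@phase_measure R n).
Local Notation TP := (measurableTypeR R * (V * V))%type.
Variables (I : (V -> V -> R -> R) -> V -> V -> R -> R) (f : V -> V -> R -> R).
Hypothesis I_meas : measurable_phase (I f).
Hypothesis I_meso : mesoscopic_interaction I f.
Hypothesis I_int : integrable_interaction I f.

Local Notation K T := (time_cut T (I f)).

Lemma integrable_time_cut_weight T : 0 <= T ->
  (mu \x m)%E.-integrable setT
    (fun p : TP => (K T p * (1 + enorm p.2.2 ^+ 2))%:E).
Proof.
move=> T0.
have mK := measurable_time_cut T I_meas.
have mw : measurable_fun setT (fun p : TP => 1 + enorm p.2.2 ^+ 2).
  apply: measurable_funD; first exact: measurable_cst.
  apply: measurable_funX; apply: measurable_enorm.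
  exact: (measurableT_comp measurable_snd measurable_snd).
apply/integrableP; split; first exact/measurable_EFinP/measurable_funM.
rewrite fubini_tonelli1//; last first.
  by apply: measurableT_comp => //; exact/measurable_EFinP/measurable_funM.
have := I_int T0; rewrite integral_mkcond; congr (_ < _)%E.
apply: eq_integral => s _; rewrite /fubini_F patchE; case: ifPn => sT.
  apply: eq_integral => z _ /=.
  have w0 : 0 <= 1 + enorm z.2 ^+ 2 by rewrite addr_ge0// sqr_ge0.
  by move: sT; rewrite inE/= in_itv/= /time_cut/= => ->; rewrite normrM (ger0_norm w0).
apply/esym; apply: integral0_eq => z _ /=.
move: sT; rewrite notin_setE/= in_itv/= /time_cut/= => /negP/negbTE->.
by rewrite mul0r normr0.
Qed.

Lemma meso_quadratic T (s : R) (x : V) (psi : V -> R) (al ga : R) (be : V) :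
  (forall xi, psi xi = al + dotv be xi + ga * enorm xi ^+ 2) ->
  (\int[lambda]_xi (K T (s, (x, xi)) * psi xi)%:E = 0)%E.
Proof.
move=> psiE; pose k xi := K T (s, (x, xi)).
have mk : measurable_fun setT k.
  apply: (measurableT_comp (measurable_time_cut T I_meas)).
  by apply: measurableT_comp => //; exact: pair1_measurable.
have k0 (c : V -> R) : measurable_fun setT c ->
    (0 <= s -> (\int[lambda]_xi (I f x xi s * c xi)%:E = 0)%E) ->
    lambda.-integrable setT (fun xi => (k xi * c xi)%:E) /\
    (\int[lambda]_xi (k xi * c xi)%:E = 0)%E.
  move=> mc Ic0.
  have kc0 : (\int[lambda]_xi (k xi * c xi)%:E = 0)%E.
    rewrite /k /time_cut/=; case: (boolP (0 <= s <= T)) => [/andP[s0 _]|_].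
      exact: Ic0.
    by apply: integral0_eq => xi _; rewrite mul0r.
  have mkc : measurable_fun setT (fun xi => k xi * c xi) by exact: measurable_funM.
  (* A finite value of the integral forces absolute convergence, so every moment of [k] is
     integrable and the balance laws may be combined linearly. *)
  split=> //; apply/integrableP; split; first exact/measurable_EFinP.
  by rewrite integral_fin_num_abs// kc0.
have [ik1 k1] : lambda.-integrable setT (fun xi => (k xi * 1)%:E) /\
    (\int[lambda]_xi (k xi * 1)%:E = 0)%E.
  apply: (k0 (fun=> 1)); first exact: measurable_cst.
  by move=> s0; under eq_integral do rewrite mulr1; have [] := I_meso x s0.
have [ik2 k2] := k0 (fun xi => enorm xi ^+ 2)
  (measurable_funX 2 (measurable_enorm (@measurable_id _ _ setT)))
  (fun s0 => let: And3 _ h _ := I_meso x s0 in h).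
have [ik3 k3] : (lambda.-integrable setT (fun xi => (k xi * dotv be xi)%:E) /\
    \int[lambda]_xi (k xi * dotv be xi)%:E = 0)%E.
  have kE xi : (k xi * dotv be xi)%:E =
      (\sum_(i < n) (be ord0 i)%:E * (k xi * xi ord0 i)%:E)%E.
    under eq_bigr do rewrite -EFinM; rewrite sumEFin; congr EFin.
    by rewrite /dotv mulr_sumr; apply: eq_bigr => i _; ring.
  have ki i := k0 (fun xi => xi ord0 i) (measurable_coord i)
    (fun s0 => let: And3 _ _ h := I_meso x s0 in h i).
  under eq_fun do rewrite kE.
  split.
    by apply: integrable_sum => // i _; apply: integrableZl => //; exact: (ki i).1.
  rewrite integral_sum//; last by move=> i; apply: integrableZl => //; exact: (ki i).1.
  by apply: big1 => i _; rewrite integralZl//; [rewrite (ki i).2 mule0 | exact: (ki i).1].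
transitivity (\int[lambda]_xi (al%:E * (k xi * 1)%:E + (k xi * dotv be xi)%:E
    + ga%:E * (k xi * enorm xi ^+ 2)%:E))%E.
  by apply: eq_integral => xi _; rewrite psiE -!EFinM -!EFinD; congr EFin; rewrite /k; ring.
have ial : lambda.-integrable setT (fun xi => al%:E * (k xi * 1)%:E)%E by exact: integrableZl.
have iga : lambda.-integrable setT (fun xi => ga%:E * (k xi * enorm xi ^+ 2)%:E)%E by exact: integrableZl.
rewrite integralD//; last exact: integrableD.
by rewrite integralD// !integralZl// k1 k2 k3 !mule0 !adde0.
Qed.
End interaction.

(** * Growth along a single trajectory *)

Section growth_on_interval.
Context {R : realType}.
Local Notation mu := (@lebesgue_measure R).
Variables (g dg : R -> R) (T : R).
Hypothesis g0 : g y @[y --> (0 : R)^'+] --> g 0.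
Hypothesis dgE : forall s, 0 < s <= T -> is_derive s (1 : R) g (dg s).
Hypothesis idg : mu.-integrable `[0, T] (EFin \o dg).

(** The comparison of increments bounds from below, so it is applied to [- g] with the integrable
    minorant [- |dg|]. *)
Lemma increment_le_integral_abs s : 0 <= s <= T ->
  g s <= g 0 + fine (\int[mu]_(r in `[0%R, T]) `|(dg r)%:E|)%E.
Proof.
move=> /andP[]; rewrite le_eqVlt => /predU1P[<- _|s0 sT].
  by rewrite lerDl fine_ge0// integral_ge0.
have sub : [set` `[0, s]] `<=` [set` `[0, T]].
  by move=> x /=; rewrite !in_itv/= => /andP[-> /le_trans->].
have idgs : mu.-integrable `[0, s] (EFin \o dg).
  by apply: (integrableS _ _ _ idg) => //; exact: measurable_itv.
have iabs : mu.-integrable `[0, s] (EFin \o (fun r => `|dg r|)).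
  by have := integrable_abse idgs.
have := @integral_le_increment R (fun r => - g r) (fun r => - dg r)
  (fun r => - `|dg r|) 0 s s0.
have -> : (\int[mu]_(t in `[0%R, s]) (- `|dg t|)%:E =
    - (\int[mu]_(t in `[0%R, s]) `|(dg t)%:E|))%E.
  rewrite -integralN/=; last exact: integrable_add_def.
  by apply: eq_integral => x _.
move=> H.
have : (- (\int[mu]_(t in `[0%R, s]) `|(dg t)%:E|) <= (- g s - - g 0)%:E)%E.
  apply: H.
  - exact: cvgN.
  - move=> x /andP[x0 xs]; apply: is_deriveN; apply: dgE.
    by rewrite x0 (le_trans xs).
  - by move=> x _; rewrite lerN2 ler_norm.
  - exact: (integrableN iabs).
have fin : (\int[mu]_(t in `[0%R, T]) `|(dg t)%:E|)%E \is a fin_num.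
  by apply: integrable_fin_num => //; exact: integrable_abse idg.
rewrite leeNl -EFinN => /le_trans H2.
rewrite -lerBlDl -lee_fin fineK//.
have le1 : (\int[mu]_(t in `[0%R, s]) `|(dg t)%:E| <= \int[mu]_(t in `[0%R, T]) `|(dg t)%:E|)%E.
  apply: ge0_subset_integral => //; try exact: measurable_itv.
  exact: (measurable_int mu (integrable_abse idg)).
apply: le_trans le1; apply: le_trans (H2 _ (lexx _)).
by rewrite lee_fin; lra.
Qed.

Variables (P dP : R -> R) (C D : R).
Hypothesis g_ge0 : forall s, 0 <= s <= T -> 0 <= g s.
Hypothesis dPE : forall s, is_derive s (1 : R) P (dP s).
Hypothesis PC : forall s, 0 <= s <= T -> `|P s| <= C.
Hypothesis D0 : 0 <= D.
Hypothesis dPD : forall s, 0 <= s <= T -> dP s <= D.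

(** Product rule for [g * P]. As [dP] is controlled only from above, the term [g * dP] is replaced
    by the constant [G * D], where [G] bounds [g] on the interval; the other term [dg * P] is
    integrable because [P] is bounded. *)
Lemma increment_mul_le : 0 < T ->
  ((g T * P T)%:E <= (g 0 * P 0)%:E + \int[mu]_(s in `[0%R, T]) (dg s * P s)%:E
    + (T * ((g 0 + fine (\int[mu]_(r in `[0%R, T]) `|(dg r)%:E|)%E) * D))%:E)%E.
Proof.
move=> T0; set G := g 0 + _.
have cP : continuous P.
  by move=> x; apply: differentiable_continuous; apply/derivable1_diffP; have [] := dPE x.
have mP : measurable_fun setT P by exact: continuous_measurable_fun.
have mdg : measurable_fun `[0, T]%classic dg.
  by apply/measurable_EFinP; exact: (measurable_int mu).
have idgP : mu.-integrable `[0, T] (EFin \o (fun s => dg s * P s)).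
  apply: (@le_integrable _ _ _ mu _ _ _ (fun s => C%:E * (dg s)%:E)%E) => //.
  - apply/measurable_EFinP/measurable_funM => //; exact: measurable_funS mP.
  - move=> s /=; rewrite in_itv/= => sT; rewrite lee_fin !normrM mulrC.
    by rewrite ler_wpM2r// (le_trans (PC sT))// ler_norm.
  - by apply: integrableZl => //; exact: measurable_itv.
have iGD : mu.-integrable `[0, T] (EFin \o (fun=> G * D)).
  apply/integrableP; split; first exact/measurable_EFinP/measurable_cst.
  rewrite integral_cst; last exact: measurable_itv.
  by rewrite /= lebesgue_measure_itv/= lte_fin T0 -EFinB -EFinM ltry.
have := @integral_le_increment R (fun r => - (g r * P r))
  (fun r => - (dg r * P r + g r * dP r)) (fun r => - (dg r * P r + G * D)) 0 T T0.
move=> H.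
have {H} : (\int[mu]_(t in `[0%R, T]) (- (dg t * P t + G * D))%:E <=
  (- (g T * P T) - - (g 0 * P 0))%:E)%E.
  apply: H.
  - apply: cvgN; apply: cvgM => //; apply: cvg_at_right_filter; exact: cP.
  - move=> x x0T; apply: is_deriveN.
    have := is_deriveM (dgE x0T) (dPE x).
    by rewrite /GRing.scale/= addrC [P x * _]mulrC.
  - move=> x /andP[/ltW x0 xT]; have xT' : 0 <= x <= T by rewrite x0.
    rewrite lerN2 lerD2l; apply: (@le_trans _ _ (g x * D)).
      by rewrite ler_wpM2l ?g_ge0 ?dPD.
    by rewrite ler_wpM2r// increment_le_integral_abs.
  - exact: (integrableN (integrableD _ idgP iGD)).
have -> : (\int[mu]_(t in `[0%R, T]) (- (dg t * P t + G * D))%:E =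
   - (\int[mu]_(t in `[0%R, T]) (dg t * P t)%:E + (T * (G * D))%:E))%E.
  have iD : mu.-integrable `[0, T] (EFin \o (fun t => dg t * P t + G * D)).
    exact: (integrableD _ idgP iGD).
  under eq_integral do rewrite EFinN.
  rewrite integralN/=; last exact: integrable_add_def.
  congr (- _)%E; under eq_integral do rewrite EFinD.
  rewrite integralD//.
  rewrite integral_cst; last exact: measurable_itv.
  by rewrite /= lebesgue_measure_itv/= lte_fin T0 -EFinB -EFinM subr0 (mulrC T).
have fin : (\int[mu]_(s in `[0%R, T]) (dg s * P s)%:E)%E \is a fin_num.
  by apply: integrable_fin_num => //; exact: measurable_itv.
rewrite -(fineK fin) -!EFinD -EFinN !lee_fin; lra.
Qed.

End growth_on_interval.

Lemma ae_le_integral d (T : measurableType d) (R : realType)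
    (mu : {measure set T -> \bar R}) (f1 f2 : T -> \bar R) :
  mu.-integrable setT f1 -> mu.-integrable setT f2 ->
  {ae mu, forall x, (f1 x <= f2 x)%E} ->
  (\int[mu]_x f1 x <= \int[mu]_x f2 x)%E.
Proof.
move=> i1 i2 le12.
have m1 := measurable_int mu i1; have m2 := measurable_int mu i2.
rewrite integralE [leRHS]integralE; apply: leeB.
  apply: ae_ge0_le_integral => //.
  - exact: measurable_funepos.
  - exact: measurable_funepos.
  - apply: filterS le12 => x le12 _; rewrite !funeposE.
    by rewrite ge_max !le_max le12 lexx orbT.
apply: ae_ge0_le_integral => //.
- exact: measurable_funeneg.
- exact: measurable_funeneg.
- apply: filterS le12 => x le12 _; rewrite !funenegE.
  by rewrite ge_max !le_max leeN2 le12 lexx orbT.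
Qed.

Lemma integrable_fubini_G d1 d2 (T1 : measurableType d1) (T2 : measurableType d2)
    (R : realType) (m1 : {sigma_finite_measure set T1 -> \bar R})
    (m2 : {sigma_finite_measure set T2 -> \bar R}) (h : T1 * T2 -> \bar R) :
  (m1 \x m2)%E.-integrable setT h -> m2.-integrable setT (fubini_G m1 h).
Proof.
move=> /integrableP[mh ih].
have mG : measurable_fun setT (fubini_G m1 h).
  rewrite (_ : fubini_G m1 h =
      fun y => (fubini_G m1 h^\+ y - fubini_G m1 h^\- y)%E); last first.
    apply/funext => y; rewrite /fubini_G integralE; congr (_ - _)%E.
      by apply: eq_integral => x _; rewrite !funeposE.
    by apply: eq_integral => x _; rewrite !funenegE.
  apply: emeasurable_funB.
    apply: measurable_fun_fubini_tonelli_G; first exact: measurable_funepos.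
    by move=> p; exact: funepos_ge0.
  apply: measurable_fun_fubini_tonelli_G; first exact: measurable_funeneg.
  by move=> p; exact: funeneg_ge0.
apply/integrableP; split=> //.
apply: le_lt_trans ih; rewrite fubini_tonelli2//; last exact: measurableT_comp.
apply: ae_ge0_le_integral => //.
- exact: measurableT_comp.
- by move=> y _; exact: integral_ge0.
- apply: measurable_fun_fubini_tonelli_G => //; exact: measurableT_comp.
- apply: aeW => y _; apply: le_abse_integral => //.
  exact: (measurableT_comp mh (pair2_measurable _)).
Qed.

(** * Integrated balance for test functions quadratic in the velocity *)

Section transport.
Context {R : realType} {n : nat}.
Local Notation V := 'rV[R]_n.
Local Notation lambda := (lebesgue_rV R n).
Local Notation mu := (@lebesgue_measure R).
Local Notation m := (@phase_measure R n).
Local Notation TP := (measurableTypeR R * (V * V))%type.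
Variables (I : (V -> V -> R -> R) -> V -> V -> R -> R).
Variables (f0 : V -> V -> R) (f : V -> V -> R -> R).
Hypothesis f_meas : measurable_phase f.
Hypothesis I_meas : measurable_phase (I f).
Hypothesis f_ge0 : forall x xi t, 0 <= t -> 0 <= f x xi t.
Hypothesis f_sol : kinetic_solution I f0 f.
Hypothesis I_meso : mesoscopic_interaction I f.
Hypothesis I_int : integrable_interaction I f.

Definition weight (z : V * V) : R := 1 + enorm z.2 ^+ 2.

Lemma weight_ge1 z : 1 <= weight z.
Proof. by rewrite lerDl sqr_ge0. Qed.

Lemma weight_gt0 z : 0 < weight z.
Proof. exact: lt_le_trans (weight_ge1 z). Qed.

Lemma measurable_at_time t : 0 <= t ->
  measurable_fun setT (fun z : V * V => f z.1 z.2 t).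
Proof.
move=> t0; have := measurableT_comp (measurable_time_cut t f_meas) (pair1_measurable (t : measurableTypeR R)).
by apply: eq_measurable_fun => z _; rewrite /time_cut/= t0 lexx.
Qed.

Hypothesis i0 : m.-integrable setT (fun z => (f z.1 z.2 0 * weight z)%:E).

Variable T : R.
Hypothesis T_gt0 : 0 < T.

Let K := time_cut T (I f).
Let J (p : TP) := K (flow p).

Lemma integrable_along :
  (mu \x m)%E.-integrable setT (fun p : TP => (J p * weight p.2)%:E).
Proof. exact: (integrable_flow (integrable_time_cut_weight I_meas I_int (ltW T_gt0))). Qed.

(* A majorant of [f (x + s xi) xi s * weight] for all [s] in [0, T]. *)
Definition trajectory_bound (z : V * V) : R :=
  f z.1 z.2 0 * weight z + fine (\int[mu]_s `|(J (s, z) * weight z)%:E|)%E.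

Lemma integrable_trajectory_bound : m.-integrable setT (EFin \o trajectory_bound).
Proof.
have iA : m.-integrable setT (fubini_G mu (fun p : TP => `|(J p * weight p.2)%:E|%E)).
  exact: (integrable_fubini_G (integrable_abse integrable_along)).
have iB : m.-integrable setT
    (fun z => (fine (\int[mu]_s `|(J (s, z) * weight z)%:E|)%E)%:E).
  apply: (le_integrable _ _ _ iA) => //.
    apply/measurable_EFinP; apply: measurableT_comp => //.
    exact: (measurable_int m iA).
  (* [fine] sends infinite values to 0, so the bound also holds where the inner integral
     diverges. *)
  have abs_fine (a : \bar R) : (`|(fine a)%:E| <= `|a|)%E by case: a => [r| |] //=; rewrite normr0 leey.
  by move=> z _; exact: abs_fine.
exact: (integrableD _ i0 iB).
Qed.

Let dg (z : V * V) (s : R) := I f (z.1 + s *: z.2) z.2 s * weight z.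

Lemma trajectory_derive (z : V * V) (s : R) : 0 < s ->
  is_derive s (1 : R) (fun s => f (z.1 + s *: z.2) z.2 s * weight z) (dg z s).
Proof.
move=> s0; have [_ _ /(_ s s0) df] := f_sol z.1 z.2.
have -> : (fun s => f (z.1 + s *: z.2) z.2 s * weight z) =
  weight z *: (fun s => f (z.1 + s *: z.2) z.2 s : R).
  by apply/funext => r; rewrite mulrC.
have := is_deriveZ (weight z) df.
by rewrite /dg mulrC.
Qed.

Lemma trajectory_cvg0 (z : V * V) :
  f (z.1 + s *: z.2) z.2 s * weight z @[s --> (0 : R)^'+] -->
  f (z.1 + 0 *: z.2) z.2 0 * weight z.
Proof.
have [_ cf _] := f_sol z.1 z.2.
by apply: cvgM; [rewrite scale0r addr0 | exact: cvg_cst].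
Qed.

Lemma patched_trajectory z (h : R -> R) :
  (fun s => (J (s, z) * weight z * h s)%:E) =
  (EFin \o (fun s => dg z s * h s)) \_ `[0, T].
Proof.
apply/funext => s; rewrite patchE /J /K /time_cut /dg/=.
case: ifPn => [sT|sT]; first by rewrite mem_set//= in_itv.
by rewrite memNset ?mul0r//= in_itv/=; exact/negP.
Qed.

Variables (psi : TP -> R) (C : R) (dpsi : V * V -> R -> R) (delta : V * V -> R).
Hypothesis mpsi : measurable_fun setT psi.
Hypothesis psi_quad : forall s x, exists al be ga, forall xi : V,
  psi (s, (x, xi)) = al + dotv be xi + ga * enorm xi ^+ 2.
Hypothesis psi_bound : forall p : TP, 0 <= p.1 <= T -> `|psi p| <= C * weight p.2.
Hypothesis psi_derive : forall z s,
  is_derive s (1 : R) (fun s => psi (flow (s, z))) (dpsi z s).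
Hypothesis dpsi_le : forall z s, 0 <= s <= T -> dpsi z s <= weight z * delta z.
Hypothesis mdelta : measurable_fun setT delta.
Variable D : R.
Hypothesis delta_bound : forall z, 0 <= delta z <= D.

(** Stated for a general [H] because it serves both the interaction [K] in phase coordinates and its
    pullback [J] by the flow. *)
Lemma integrable_cut_psi (H : TP -> R) : measurable_fun setT H ->
  (forall p : TP, ~~ (0 <= p.1 <= T) -> H p = 0) ->
  (mu \x m)%E.-integrable setT (fun p : TP => (H p * weight p.2)%:E) ->
  forall phi : TP -> R, measurable_fun setT phi ->
  (forall p : TP, 0 <= p.1 <= T -> `|phi p| <= C * weight p.2) ->
  (mu \x m)%E.-integrable setT (fun p : TP => (H p * phi p)%:E).
Proof.
move=> mH H0 iH phi mphi phiC.
apply: (@le_integrable _ _ _ (mu \x m)%E _ _ _ (fun p : TP => C%:E * (H p * weight p.2)%:E)%E) => //.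
- exact/measurable_EFinP/measurable_funM.
- move=> p _; rewrite lee_fin !normrM.
  have [pT|pT] := boolP (0 <= p.1 <= T); last by rewrite H0// normr0 !(mul0r, mulr0).
  rewrite mulrCA ler_wpM2l//; apply: le_trans (phiC _ pT) _.
  by rewrite -normrM ler_norm.
- exact: integrableZl.
Qed.

Let mK : measurable_fun setT K := measurable_time_cut T I_meas.
Let mJ : measurable_fun setT J.
Proof. exact: (measurableT_comp mK measurable_flow). Qed.
Let mpsif : measurable_fun setT (fun p => psi (flow p)).
Proof. exact: (measurableT_comp mpsi measurable_flow). Qed.

Let K_out (p : TP) : ~~ (0 <= p.1 <= T) -> K p = 0.
Proof. by rewrite /K /time_cut => /negbTE->. Qed.

Lemma integrable_source : (mu \x m)%E.-integrable setT (fun p => (J p * psi (flow p))%:E).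
Proof.
apply: integrable_cut_psi => //; last 1 first.
- by move=> p pT; exact: (psi_bound (p := flow p)).
- by move=> p pT; apply: K_out.
- exact: integrable_along.
Qed.

(** The integrand is the pullback of [K * psi] by the flow. Back in phase coordinates [psi] is a
    quadratic polynomial in [xi] at each time and position, which a mesoscopic interaction
    annihilates. *)
Lemma integral_source : (\int[mu \x m]_p (J p * psi (flow p))%:E = 0)%E.
Proof.
rewrite (@integral_flow _ _ (fun p => (K p * psi p)%:E)); last first.
  exact/measurable_EFinP/measurable_funM.
apply: integral_time_phase_eq0.
  apply: integrable_cut_psi => //.
  exact: (integrable_time_cut_weight I_meas I_int (ltW T_gt0)).
move=> s x; have [al [be [ga psiE]]] := psi_quad s x.
exact: (@meso_quadratic _ _ I f I_meas I_meso T s x (fun xi => psi (s, (x, xi))) al ga be psiE).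
Qed.

(** By Fubini the derivative along the trajectory is integrable in time for almost every starting
    point. There the growth estimate is used with [g = f * weight] and [P = psi / weight]: this
    quotient is bounded by [C], and its derivative is at most [delta z]. *)
Lemma ae_trajectory_balance : {ae m, forall z,
  `|f (z.1 + T *: z.2) z.2 T * psi (flow (T, z))| <= C * trajectory_bound z /\
  ((f (z.1 + T *: z.2) z.2 T * psi (flow (T, z)))%:E <=
   (f z.1 z.2 0 * psi (0%R, z))%:E + fubini_G mu (fun p => (J p * psi (flow p))%:E) z
   + (T * (trajectory_bound z * delta z))%:E)%E}.
Proof.
have := ae_integrable2 integrable_along; apply: filterS => z iJ.
have dg1 : EFin \o dg z = EFin \o (fun s => dg z s * 1).
  by apply/funext => s /=; rewrite mulr1.
have J1 : (fun s => (J (s, z) * weight z)%:E) = (fun s => (J (s, z) * weight z * 1)%:E).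
  by apply/funext => s; rewrite mulr1.
have idg : mu.-integrable `[0, T] (EFin \o dg z).
  rewrite dg1; apply: (@integrable_mkcond _ _ _ mu `[0, T]%classic _ (measurable_itv _)).2.
  by rewrite -patched_trajectory -J1; exact: iJ.
have Aeq : (\int[mu]_(r in `[0%R, T]) `|(dg z r)%:E| = \int[mu]_s `|(J (s, z) * weight z)%:E|)%E.
  rewrite integral_mkcond; apply: eq_integral => s _.
  have Js : (J (s, z) * weight z)%:E = ((EFin \o (fun s => dg z s * 1)) \_ `[0, T]) s.
    by rewrite -patched_trajectory mulr1.
  rewrite [X in _ = `|X|%E]Js !patchE; case: ifPn => _; last by rewrite abse0.
  by rewrite /= mulr1.
have Beq : fubini_G mu (fun p => (J p * psi (flow p))%:E) z =
  (\int[mu]_(s in `[0%R, T]) (dg z s * (psi (flow (s, z)) / weight z))%:E)%E.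
  rewrite integral_mkcond /fubini_G.
  have -> : (fun s => (dg z s * (psi (flow (s, z)) / weight z))%:E) =
    EFin \o (fun s => dg z s * (psi (flow (s, z)) / weight z)) by [].
  rewrite -patched_trajectory; apply: eq_integral => s _.
  by rewrite mulrACA divff ?mulr1// gt_eqF// weight_gt0.
have TT : 0 <= T <= T by rewrite lexx ltW.
have wz := weight_gt0 z.
have f_along s : 0 <= s -> 0 <= f (z.1 + s *: z.2) z.2 s * weight z.
  by move=> s0; rewrite mulr_ge0 ?f_ge0// ltW.
have dgE s : 0 < s <= T -> is_derive s (1 : R)
    (fun s => f (z.1 + s *: z.2) z.2 s * weight z) (dg z s).
  by move=> /andP[s0 _]; exact: trajectory_derive.
have g0E : f (z.1 + 0 *: z.2) z.2 0 = f z.1 z.2 0 by rewrite scale0r addr0.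
have gT : f (z.1 + T *: z.2) z.2 T * weight z <= trajectory_bound z.
  have := increment_le_integral_abs (@trajectory_cvg0 z) dgE idg TT.
  by rewrite Aeq g0E.
split.
  rewrite normrM ger0_norm ?f_ge0 ?(ltW T_gt0)//.
  have := psi_bound (p := flow (T, z)) TT; rewrite {2}/flow/= /weight/= -/(weight z) => psiT.
  have C0 : 0 <= C by rewrite -(pmulr_lge0 _ wz); exact: le_trans psiT.
  apply: (@le_trans _ _ (C * (f (z.1 + T *: z.2) z.2 T * weight z))).
    by rewrite mulrCA ler_wpM2l ?f_ge0 ?(ltW T_gt0).
  by rewrite ler_wpM2l.
pose P s := psi (flow (s, z)) / weight z.
have dPE s : is_derive s (1 : R) P (dpsi z s / weight z).
  have -> : P = (weight z)^-1 *: (fun s => psi (flow (s, z)) : R).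
    by apply/funext => r; rewrite /P mulrC.
  by have := is_deriveZ (weight z)^-1 (psi_derive z s); rewrite mulrC.
have PC s : 0 <= s <= T -> `|P s| <= C.
  move=> sT; rewrite /P normrM normfV (gtr0_norm wz) ler_pdivrMr//.
  exact: (psi_bound (p := flow (s, z)) sT).
have dP_le s : 0 <= s <= T -> dpsi z s / weight z <= delta z.
  by move=> sT; rewrite ler_pdivrMr// mulrC dpsi_le.
have delta0 : 0 <= delta z by case/andP: (delta_bound z).
have := increment_mul_le (@trajectory_cvg0 z) dgE idg
  (fun s sT => f_along s (andP sT).1) dPE PC delta0 dP_le T_gt0.
rewrite Aeq g0E -Beq /P.
have cancel_weight a b : a * weight z * (b / weight z) = a * b.
  by rewrite mulrACA divff ?gt_eqF// mulr1.
rewrite !cancel_weight.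
by rewrite [flow (0, z)]/flow/= scale0r addr0 -surjective_pairing.
Qed.

Let mfT t : 0 <= t -> measurable_fun setT (fun z => f z.1 z.2 t * psi (t, z)).
Proof.
move=> t0; apply: measurable_funM; first exact: measurable_at_time.
exact: (measurableT_comp mpsi (pair1_measurable _)).
Qed.

(** The trajectory inequality is integrated over starting points: the shear turns its left side into
    an integral at time [T], and the source integrates to zero. Since [delta] does not depend on
    time, the error keeps the form [T] times one phase integral. *)
Theorem transport_balance :
  m.-integrable setT (fun z => (f z.1 z.2 T * psi (T, z))%:E) /\
  (\int[m]_z (f z.1 z.2 T * psi (T, z))%:E <=
   \int[m]_z (f z.1 z.2 0 * psi (0%R, z))%:E
   + T%:E * \int[m]_z (trajectory_bound z * delta z)%:E)%E.
Proof.
have T0 := ltW T_gt0.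
pose h z := (f z.1 z.2 T * psi (T, z))%:E.
have mh : measurable_fun setT h by apply/measurable_EFinP; exact: mfT.
have mhs : measurable_fun setT (fun z : V * V => h (z.1 + T *: z.2, z.2)).
  exact: (measurableT_comp mh (measurable_shear T)).
have iG := integrable_trajectory_bound.
have ihs : m.-integrable setT (fun z : V * V => h (z.1 + T *: z.2, z.2)).
  apply/integrableP; split=> //.
  have iCG : m.-integrable setT (fun z => C%:E * (trajectory_bound z)%:E)%E by exact: integrableZl.
  apply: (@le_lt_trans _ _ (\int[m]_z `|C%:E * (trajectory_bound z)%:E|)%E); last first.
    by have /integrableP[] := iCG.
  apply: ae_ge0_le_integral => //.
  - exact: measurableT_comp.
  - exact: (measurable_int m (integrable_abse iCG)).
  - apply: filterS ae_trajectory_balance => z [fb _] _.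
    by rewrite /h/= lee_fin (le_trans fb)// ler_norm.
split.
  apply/integrableP; split=> //.
  have /integrableP[_] := ihs.
  by rewrite (@ge0_integral_shear _ _ T (fun z => `|h z|%E))//; exact: measurableT_comp.
have -> : (\int[m]_z h z = \int[m]_z h (z.1 + T *: z.2, z.2)%R)%E.
  rewrite [LHS]integralE [RHS]integralE; congr (_ - _)%E.
    rewrite -(ge0_integral_shear T (measurable_funepos mh) (funepos_ge0 h)).
    by apply: eq_integral => z _; rewrite !funeposE.
  rewrite -(ge0_integral_shear T (measurable_funeneg mh) (funeneg_ge0 h)).
  by apply: eq_integral => z _; rewrite !funenegE.
have iGd : m.-integrable setT (fun z => (trajectory_bound z * delta z)%:E).
  apply: (@le_integrable _ _ _ m _ _ _ (fun z => D%:E * (trajectory_bound z)%:E)%E) => //.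
  - apply/measurable_EFinP/measurable_funM => //.
    by apply/measurable_EFinP; exact: (measurable_int m iG).
  - move=> z _; rewrite lee_fin !normrM mulrC ler_wpM2r//.
    have /andP[d0 dD] := delta_bound z.
    by rewrite !ger0_norm// (le_trans d0).
  - exact: integrableZl.
have if0 : m.-integrable setT (fun z => (f z.1 z.2 0 * psi (0%R, z))%:E).
  apply: (@le_integrable _ _ _ m _ _ _ (fun z => C%:E * (f z.1 z.2 0 * weight z)%:E)%E) => //.
  - by apply/measurable_EFinP; exact: mfT.
  - move=> z _; rewrite lee_fin !normrM mulrCA ler_wpM2l//.
    have TT : 0 <= (0 : R) <= T by rewrite lexx.
    by rewrite -normrM (le_trans (psi_bound (p := (0%R, z)) TT))// ler_norm.
  - exact: integrableZl.
have iS := integrable_fubini_G integrable_source.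
have S0 : (\int[m]_z fubini_G mu (fun p => (J p * psi (flow p))%:E) z = 0)%E.
  by rewrite integral21_prod_meas1; [exact: integral_source | exact: integrable_source].
have iTGd : m.-integrable setT (fun z => (T * (trajectory_bound z * delta z))%:E).
  by under eq_fun do rewrite EFinM; exact: integrableZl.
apply: (@le_trans _ _ (\int[m]_z ((f z.1 z.2 0 * psi (0%R, z))%:E
    + fubini_G mu (fun p => (J p * psi (flow p))%:E) z
    + (T * (trajectory_bound z * delta z))%:E))%E).
  apply: ae_le_integral => //.
    by apply: integrableD => //; exact: integrableD.
  by apply: filterS ae_trajectory_balance => z [].
rewrite integralD//; last exact: integrableD.
rewrite integralD// S0 adde0 leeD2l//.
by under eq_integral do rewrite EFinM; rewrite integralZl.
Qed.
End transport.

(** * The regularized virial *)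

Section virial.
Context {R : realType} {n : nat}.
Local Notation V := 'rV[R]_n.
Local Notation TP := (measurableTypeR R * (V * V))%type.

(* For [e = 0] this is [|y|^2 - y . xi + |xi|^2] with [y = x - s xi], which is
   constant along free trajectories.  For [e > 0] the weight is bounded by a
   multiple of [1 + |xi|^2], the coefficient of [x . xi] being half the
   gradient of [q / (1 + e q)], [q = |x|^2]; then its derivative along
   trajectories involves no power of [xi] above the second. *)
Definition virial (e : R) (p : TP) : R :=
  let: (s, (x, xi)) := p in
  let u := (1 + e * dotv x x)^-1 in
  dotv x x * u - (2 * (s : R) + 1) * (u ^+ 2 * dotv x xi)
  + ((s : R) ^+ 2 + s + 1) * dotv xi xi.

(** Differentiating [q u] gives [2 u^2 x . xi], by [e q u = 1 - u]; the half-gradient coefficient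
    cancels exactly this term. The rest is quadratic in the velocity at fixed [x] and vanishes when
    [u = 1], that is for [e = 0]. *)
Definition virial_rate (e : R) (z : V * V) (s : R) : R :=
  let x := z.1 + s *: z.2 in
  let u := (1 + e * dotv x x)^-1 in
  (2 * s + 1) * (dotv z.2 z.2 * (1 - u ^+ 2) + 4 * e * dotv x z.2 ^+ 2 * u ^+ 3).

Lemma virial_quadratic e s x : exists al be ga, forall xi : V,
  virial e (s, (x, xi)) = al + dotv be xi + ga * enorm xi ^+ 2.
Proof.
pose u := (1 + e * dotv x x)^-1.
exists (dotv x x * u), (- ((2 * (s : R) + 1) * u ^+ 2) *: x), ((s : R) ^+ 2 + s + 1).
by move=> xi; rewrite /virial -/u sqr_enorm dotvZl; ring.
Qed.

(** Completing the square after multiplication by [c]; if [c = 0] then [B = 0]. With [r = 2 s + 1]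
    the coefficient [(r ^+ 2 + 3) / 4] is the [s ^+ 2 + s + 1] of the virial. *)
Lemma quadratic_form_ge0 (A B c r : R) : 0 <= A -> 0 <= c -> B ^+ 2 <= A * c ->
  0 <= A - r * B + (r ^+ 2 + 3) / 4 * c.
Proof.
move=> A0; rewrite le_eqVlt => /predU1P[<-|c0 BAc].
  rewrite mulr0 => B0; have : B ^+ 2 == 0 by rewrite eq_le B0 sqr_ge0.
  by rewrite sqrf_eq0 => /eqP->; rewrite !mulr0 subr0 addr0.
rewrite -(pmulr_rge0 _ c0).
have -> : c * (A - r * B + (r ^+ 2 + 3) / 4 * c) =
  (r / 2 * c - B) ^+ 2 + (A * c - B ^+ 2) + 3 / 4 * c ^+ 2 by field.
apply: addr_ge0; first by apply: addr_ge0; [exact: sqr_ge0 | rewrite subr_ge0].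
by apply: mulr_ge0; [lra | exact: sqr_ge0].
Qed.

Lemma norm_le_mean (X k c : R) : 0 <= k -> 0 <= c -> X ^+ 2 <= k * c ->
  `|X| <= (k + c) / 2.
Proof.
move=> k0 c0 Xkc; rewrite -ler_sqr ?nnegrE ?divr_ge0 ?addr_ge0// real_normK ?num_real//.
apply: (le_trans Xkc); rewrite -subr_ge0.
have -> : ((k + c) / 2) ^+ 2 - k * c = ((k - c) / 2) ^+ 2 by field.
exact: sqr_ge0.
Qed.

Lemma defect_scale_ge0 (T : R) (y xi : V) : 0 <= 2 * (dotv y y + T ^+ 2 * dotv xi xi).
Proof.
apply: mulr_ge0 => //; apply: addr_ge0; first exact: dotv_ge0.
by apply: mulr_ge0; [exact: sqr_ge0 | exact: dotv_ge0].
Qed.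

Section cutoff.
Variable e : R.
Hypothesis e_gt0 : 0 < e.

Lemma cutoff_inv (q : R) : 0 <= q ->
  0 < (1 + e * q)^-1 <= 1 /\ e * q * (1 + e * q)^-1 = 1 - (1 + e * q)^-1.
Proof.
move=> q0; have d1 : 1 <= 1 + e * q by rewrite lerDl mulr_ge0// ltW.
have d0 : 0 < 1 + e * q by exact: lt_le_trans d1.
split; first by rewrite invr_gt0 d0 invf_le1.
have := mulfV (lt0r_neq0 d0); lra.
Qed.

(** Cauchy-Schwarz together with [u^4 <= u], as [u] lies in []0, 1]]. It is the discriminant
    condition for the positivity of the regularized virial. *)
Lemma cutoff_sqr_dotv_le (x xi : V) : let u := (1 + e * dotv x x)^-1 in
  (u ^+ 2 * dotv x xi) ^+ 2 <= dotv x x * u * dotv xi xi.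
Proof.
have [/andP[u0 u1] _] /= := cutoff_inv (dotv_ge0 x); set u := _^-1 in u0 u1 *.
rewrite exprMn; apply: (@le_trans _ _ (u * (dotv x x * dotv xi xi))); last by rewrite mulrCA mulrA.
apply: ler_pM; rewrite ?sqr_ge0 ?sqr_dotv_le//.
by rewrite -exprM exprS ler_piMr ?exprn_ile1 ?(ltW u0).
Qed.

Lemma virial_ge0 p : 0 <= virial e p.
Proof.
case: p => s [x xi]; rewrite /virial.
have [/andP[u0 u1] _] := cutoff_inv (dotv_ge0 x); set u := _^-1 in u0 u1 *.
have -> : (s : R) ^+ 2 + s + 1 = ((2 * (s : R) + 1) ^+ 2 + 3) / 4 by field.
apply: quadratic_form_ge0; [|exact: dotv_ge0|exact: cutoff_sqr_dotv_le].
by rewrite mulr_ge0 ?dotv_ge0// ltW.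
Qed.

Lemma virial_bound T p : 0 <= p.1 <= T ->
  `|virial e p| <= ((T + 2) * e^-1 + (T + 2) ^+ 2) * weight p.2.
Proof.
case: p => s [x xi]; rewrite (ger0_norm (virial_ge0 _)) => /= /andP[s0 sT].
have [/andP[u0 u1] eu] := cutoff_inv (dotv_ge0 x).
have Xkc := cutoff_sqr_dotv_le x xi.
rewrite /virial /weight/= sqr_enorm.
set u := _^-1 in u0 u1 eu Xkc *; set X := u ^+ 2 * _ in Xkc *.
set k := dotv x x * u in Xkc *; set c := dotv xi xi in Xkc *.
have c0 : 0 <= c by exact: dotv_ge0.
have k0 : 0 <= k by rewrite mulr_ge0 ?dotv_ge0// ltW.
(* This is where the regularization removes the growth in [x]: [e k = 1 - u <= 1]. The virial is
   then at most [(T + 3/2) / e + (T^2 + 2 T + 3/2) c], which the stated constant covers. *)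
have kE : k <= e^-1.
  by rewrite -(ler_pM2l e_gt0) /k mulrA eu mulfV ?gt_eqF// gerBl ltW.
have XM := norm_le_mean k0 c0 Xkc.
have NX : - X <= (k + c) / 2 by apply: le_trans XM; rewrite -normrN ler_norm.
have E0 : 0 < e^-1 by rewrite invr_gt0.
move: (s : R) s0 sT => {}s s0 sT.
have h1 : (2 * s + 1) * - X <= (2 * T + 1) * ((e^-1 + c) / 2).
  apply: (@le_trans _ _ ((2 * s + 1) * ((k + c) / 2))).
    by rewrite ler_wpM2l//; lra.
  apply: ler_pM; lra.
have h2 : (s ^+ 2 + s + 1) * c <= (T ^+ 2 + T + 1) * c.
  by rewrite ler_wpM2r// !lerD// lerXn2r// nnegrE ?(le_trans s0).
have T0 : 0 <= T by exact: le_trans sT.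
have h3 : 0 <= T * c by exact: mulr_ge0.
have h4 : 0 <= T * (e^-1 * c) by rewrite !mulr_ge0// ltW.
have h5 : 0 <= e^-1 * c by rewrite mulr_ge0// ltW.
have h6 : 0 <= T ^+ 2 * c by rewrite mulr_ge0// sqr_ge0.
have h7 : 0 <= T ^+ 2 by exact: sqr_ge0.
lra.
Qed.

Lemma virial_derive z (s : R) :
  is_derive s (1 : R) (fun s => virial e (flow (s, z))) (virial_rate e z s).
Proof.
case: z => y xi; rewrite /virial_rate/=.
set a := dotv y y; set b := dotv y xi; set c := dotv xi xi.
pose q (s : R) := a + 2 * b * s + c * s ^+ 2.
pose p (s : R) := b + c * s.
have qE (r : R) : dotv (y + r *: xi) (y + r *: xi) = q r.
  by rewrite /q !(dotvDl, dotvDr, dotvZl, dotvZr) (dotvC xi y) -/a -/b -/c; ring.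
have pE (r : R) : dotv (y + r *: xi) xi = p r.
  by rewrite /p dotvDl dotvZl -/b -/c mulrC.
have d0 (r : R) : 1 + e * q r != 0.
  by rewrite gt_eqF// ltr_pwDl// mulr_ge0 ?(ltW e_gt0)// -qE dotv_ge0.
have -> : (fun s => virial e (flow (s, (y, xi)))) =
    (fun s => q s * (1 + e * q s)^-1 - (2 * s + 1) * ((1 + e * q s)^-1 ^+ 2 * p s)
      + (s ^+ 2 + s + 1) * c).
  by apply/funext => r; rewrite /virial/= qE pE.
rewrite qE pE.
have dq : is_derive s (1 : R) q (2 * p s).
  by apply: is_derive_eq; rewrite /GRing.scale/= /p; ring.
have dp : is_derive s (1 : R) p c.
  by apply: is_derive_eq; rewrite /GRing.scale/=; ring.
have dd : is_derive s (1 : R) (fun s => 1 + e * q s) (e * (2 * p s)).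
  have := is_deriveD (is_derive_cst (1 : R) s 1) (is_deriveZ e dq).
  by rewrite add0r.
pose u (s : R) := (1 + e * q s)^-1.
have du : is_derive s (1 : R) u (- (1 + e * q s) ^- 2 *: (e * (2 * p s))).
  by have := is_deriveV (f := fun s => 1 + e * q s) (d0 s) dd.
have dl : is_derive s (1 : R) (fun s => 2 * s + 1) 2.
  by apply: is_derive_eq; rewrite /GRing.scale/=; ring.
have dm : is_derive s (1 : R) (fun s => (s ^+ 2 + s + 1) * c) ((2 * s + 1) * c).
  by apply: is_derive_eq; rewrite /GRing.scale/=; ring.
have H := is_deriveD (is_deriveB (is_deriveM dq du)
  (is_deriveM dl (is_deriveM (is_deriveX 2 du) dp))) dm.
have := is_derive_eq H _; apply.
rewrite /GRing.scale/= -exprVn -/(u s).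
have qu : e * q s * u s = 1 - u s.
  by have := mulVf (d0 s); rewrite -/(u s); lra.
have uf : (u ^+ 2) s = u s ^+ 2 by [].
rewrite [(u ^+ 2 * p) s](_ : _ = u s ^+ 2 * p s)// uf.
(* The computed derivative differs from [virial_rate] by exactly this multiple of
   [e q u - (1 - u)]. *)
have Z : -2 * (u s * p s * (e * q s * u s - (1 - u s))) = 0 by rewrite qu subrr !mulr0.
by apply/eqP; rewrite -subr_eq0 -Z; apply/eqP; ring.
Qed.

(** [q] bounds [|y + s xi|^2] for all [s] in [[0, T]], which removes the time from the error; the
    fraction is [1 - u] evaluated at this bound. *)
Definition virial_defect (T : R) (z : V * V) : R :=
  let q := 2 * (dotv z.1 z.1 + T ^+ 2 * dotv z.2 z.2) in
  6 * (2 * T + 1) * (e * q / (1 + e * q)).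

Lemma virial_defect_bound T z : 0 <= T -> 0 <= virial_defect T z <= 6 * (2 * T + 1).
Proof.
move=> T0; rewrite /virial_defect; set q := 2 * (dotv _ _ + _).
have q0 : 0 <= q by exact: defect_scale_ge0.
have [/andP[u0 u1] ->] := cutoff_inv q0.
have T1 : 0 <= 6 * (2 * T + 1) by lra.
rewrite mulr_ge0 ?subr_ge0//=; apply: ler_piMr => //; lra.
Qed.

Lemma virial_rate_le T z s : 0 <= s <= T ->
  virial_rate e z s <= weight z * virial_defect T z.
Proof.
case: z => y xi /andP[s0 sT]; rewrite /virial_rate /virial_defect /weight/= sqr_enorm.
set x := y + s *: xi; set c := dotv xi xi.
have c0 : 0 <= c by exact: dotv_ge0.
set r := 2 * (dotv _ _ + _).
have xr : dotv x x <= r.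
  (* Parallelogram identity: [|y + s xi|^2 + |y - s xi|^2 = 2 |y|^2 + 2 s^2 |xi|^2]. *)
  have := dotv_ge0 (y - s *: xi).
  rewrite /x /r -scaleNr !(dotvDl, dotvDr, dotvZl, dotvZr) (dotvC xi y) -/c.
  have : s ^+ 2 * c <= T ^+ 2 * c by rewrite ler_wpM2r// lerXn2r// nnegrE ?(le_trans s0).
  lra.
have [/andP[u0 u1] eu] := cutoff_inv (dotv_ge0 x).
have [/andP[v0 v1] ->] := cutoff_inv (le_trans (dotv_ge0 x) xr).
have vu : (1 + e * r)^-1 <= (1 + e * dotv x x)^-1.
  have du : 0 < 1 + e * dotv x x by rewrite -invr_gt0.
  have dv : 0 < 1 + e * r by rewrite -invr_gt0.
  by rewrite lef_pV2 ?posrE// lerD2l ler_pM2l.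
have := sqr_dotv_le x xi; rewrite -/c.
set u := (1 + e * dotv x x)^-1 in u0 u1 eu vu *.
set v := (1 + e * r)^-1 in v0 v1 vu *.
set X := dotv x xi; set q := dotv x x in eu *; move=> Xqc.
(* The factor 6 of the defect is 2 from this term plus 4 from the next one, both expressed through
   [1 - u <= 1 - v]. *)
have h1 : c * (1 - u ^+ 2) <= c * (2 * (1 - u)).
  by rewrite ler_wpM2l//; have := sqr_ge0 (1 - u); lra.
have h2 : 4 * e * X ^+ 2 * u ^+ 3 <= 4 * (c * (1 - u)).
  rewrite -eu; apply: (@le_trans _ _ (4 * e * (q * c) * u)).
    apply: ler_pM.
    - by apply: mulr_ge0; [rewrite mulr_ge0 ?(ltW e_gt0) | exact: sqr_ge0].
    - by rewrite exprn_ge0 ?(ltW u0).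
    - by rewrite ler_pM2l// mulr_gt0.
    - by rewrite exprS ler_piMr ?(ltW u0)// exprn_ile1// ltW.
  by rewrite le_eqVlt; apply/orP; left; apply/eqP; ring.
apply: (@le_trans _ _ ((2 * T + 1) * (6 * (c * (1 - v))))).
  apply: ler_pM.
  - lra.
  - apply: addr_ge0; first by rewrite mulr_ge0// subr_ge0 exprn_ile1// ltW.
    apply: mulr_ge0; last by rewrite exprn_ge0 ?(ltW u0).
    by apply: mulr_ge0; [rewrite mulr_ge0 ?(ltW e_gt0) | exact: sqr_ge0].
  - lra.
  - have : c * (1 - u) <= c * (1 - v) by rewrite ler_wpM2l//; lra.
    lra.
have h3 : 0 <= (2 * T + 1) * (1 - v) by rewrite mulr_ge0//; lra.
lra.
Qed.

End cutoff.

Lemma measurable_cutoff d (T : measurableType d) (e : R) (q : T -> R) : 0 <= e ->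
  (forall z, 0 <= q z) -> measurable_fun setT q ->
  measurable_fun setT (fun z => (1 + e * q z)^-1).
Proof.
(* The absolute value keeps the denominator positive on the whole line, so that [h] is
   continuous. *)
move=> e0 q0 mq; pose h (r : R) := (1 + e * `|r|)^-1.
have mh : measurable_fun setT h.
  apply: continuous_measurable_fun => r.
  apply: cvgV; first by rewrite gt_eqF// ltr_pwDl// mulr_ge0.
  apply: cvgD; first exact: cvg_cst.
  by apply: cvgM; [exact: cvg_cst | exact: norm_continuous].
have -> : (fun z => (1 + e * q z)^-1) = h \o q.
  by apply/funext => z; rewrite /h/= ger0_norm.
exact: measurableT_comp.
Qed.

Lemma measurable_virial e : 0 <= e -> measurable_fun setT (virial e).
Proof.
move=> e0.
have mx : measurable_fun setT (fun p : TP => p.2.1) by exact: (measurableT_comp measurable_fst measurable_snd).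
have mxi : measurable_fun setT (fun p : TP => p.2.2) by exact: (measurableT_comp measurable_snd measurable_snd).
have ms : measurable_fun setT (fun p : TP => p.1 : R) by exact: measurable_fst.
have mu : measurable_fun setT (fun p : TP => (1 + e * dotv p.2.1 p.2.1)^-1).
  apply: measurable_cutoff => //; last exact: measurable_dotv.
  by move=> z; exact: dotv_ge0.
have -> : virial e = (fun p : TP => dotv p.2.1 p.2.1 * (1 + e * dotv p.2.1 p.2.1)^-1
    - (2 * (p.1 : R) + 1) * ((1 + e * dotv p.2.1 p.2.1)^-1 ^+ 2 * dotv p.2.1 p.2.2)
    + ((p.1 : R) ^+ 2 + p.1 + 1) * dotv p.2.2 p.2.2).
  by apply/funext => -[s [x xi]].
apply: measurable_funD.
  apply: measurable_funB.
    by apply: measurable_funM => //; exact: measurable_dotv.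
  apply: measurable_funM.
    apply: measurable_funD; last exact: measurable_cst.
    by apply: measurable_funM; [exact: measurable_cst |].
  by apply: measurable_funM; [exact: measurable_funX | exact: measurable_dotv].
apply: measurable_funM; last exact: measurable_dotv.
apply: measurable_funD; last exact: measurable_cst.
by apply: measurable_funD => //; exact: measurable_funX.
Qed.

Lemma measurable_virial_defect e T : 0 <= e -> measurable_fun setT (virial_defect e T).
Proof.
move=> e0; pose q (z : V * V) := 2 * (dotv z.1 z.1 + T ^+ 2 * dotv z.2 z.2).
have mq : measurable_fun setT q.
  apply: measurable_funM; first exact: measurable_cst.
  apply: measurable_funD; first by apply: measurable_dotv; exact: measurable_fst.
  apply: measurable_funM; first exact: measurable_cst.
  by apply: measurable_dotv; exact: measurable_snd.
apply: measurable_funM; first exact: measurable_cst.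
apply: measurable_funM.
  by apply: measurable_funM; [exact: measurable_cst | exact: mq].
apply: (@measurable_cutoff _ _ e q) => // z.
exact: defect_scale_ge0.
Qed.

Lemma virial0E s x xi (y := x - (s : R) *: xi) :
  virial 0 (s, (x, xi)) = dotv y y - dotv y xi + dotv xi xi.
Proof.
rewrite /virial /y mul0r addr0 invr1 expr1n mul1r mulr1.
by rewrite !(dotvDl, dotvDr, dotvNl, dotvNr, dotvZl, dotvZr) (dotvC xi x); ring.
Qed.

(** The two sides differ by half of [|y - xi|^2], with [y = x - s xi]. *)
Lemma virial0_lower s x xi :
  (dotv (x - (s : R) *: xi) (x - (s : R) *: xi) + dotv xi xi) / 2 <= virial 0 (s, (x, xi)).
Proof.
rewrite virial0E; move: (x - _) => y.
have := dotv_ge0 (y - xi).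
rewrite !(dotvDl, dotvDr, dotvNl, dotvNr) (dotvC xi y); lra.
Qed.

Let inv_cvg (q : R) : 0 <= q -> (1 + harmonic k * q)^-1 @[k --> \oo] --> (1 : R).
Proof.
move=> q0; rewrite -[X in _ --> X]invr1; apply: cvgV; first exact: oner_neq0.
rewrite -[X in _ --> X](addr0 1) -(mul0r q).
apply: cvgD; first exact: cvg_cst.
by apply: cvgM; [exact: cvg_harmonic | exact: cvg_cst].
Qed.

Lemma virial_cvg p : virial (harmonic k) p @[k --> \oo] --> virial 0 p.
Proof.
case: p => s [x xi]; rewrite /virial mul0r addr0 invr1.
have uc := inv_cvg (dotv_ge0 x).
apply: cvgD; last exact: cvg_cst.
apply: cvgB; first by apply: cvgM; [exact: cvg_cst |].
apply: cvgM; first exact: cvg_cst.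
apply: cvgM; last exact: cvg_cst.
by rewrite expr2; under eq_fun do rewrite expr2; exact: cvgM.
Qed.

Lemma virial_defect_cvg T z : virial_defect (harmonic k) T z @[k --> \oo] --> (0 : R).
Proof.
rewrite /virial_defect; set q := 2 * (dotv _ _ + _).
have q0 : 0 <= q by exact: defect_scale_ge0.
rewrite -[X in _ --> X](mulr0 (6 * (2 * T + 1))); apply: cvgM; first exact: cvg_cst.
rewrite -[X in _ --> X](mulr1 0) -(mul0r q); apply: cvgM; last exact: inv_cvg.
by apply: cvgM; [exact: cvg_harmonic | exact: cvg_cst].
Qed.

(** The constant is independent of [e], which provides the dominating function at time zero. *)
Lemma virial_start_le e z : 0 < e ->
  virial e (0%R, z) <= 2 * (enorm z.1 ^+ 2 + enorm z.2 ^+ 2).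
Proof.
case: z => x xi e0; rewrite /virial /= !sqr_enorm.
have [/andP[u0 u1] eu] := cutoff_inv e0 (dotv_ge0 x).
have Xkc := cutoff_sqr_dotv_le e0 x xi.
set u := _^-1 in u0 u1 eu Xkc *; set X := u ^+ 2 * _ in Xkc *.
have k0 : 0 <= dotv x x * u by rewrite mulr_ge0 ?dotv_ge0// ltW.
have kx : dotv x x * u <= dotv x x by rewrite ler_piMr// dotv_ge0.
have := norm_le_mean k0 (dotv_ge0 xi) Xkc.
have : - X <= `|X| by rewrite -normrN ler_norm.
rewrite expr0n/=; have := dotv_ge0 x; have := dotv_ge0 xi; lra.
Qed.
End virial.

(** * Moments of the solution *)

Lemma limn_einf_le_lim {R : realType} (a b : (\bar R)^nat) (l : \bar R) :
  (forall k, (a k <= b k)%E) -> b k @[k --> \oo] --> l -> (limn_einf a <= l)%E.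
Proof.
move=> ab bl; rewrite limn_einf_lim -(cvg_lim _ bl)//; apply: lee_lim.
- exact: is_cvg_einfs.
- by apply/cvg_ex; exists l.
- apply: nearW => k; apply: le_trans (ab k); apply: ereal_inf_lbound.
  by exists k => //=.
Qed.

Section moments.
Context {R : realType} {n : nat}.
Local Notation V := 'rV[R]_n.
Local Notation mu := (@lebesgue_measure R).
Local Notation m := (@phase_measure R n).
Local Notation TP := (measurableTypeR R * (V * V))%type.
Variables (I : (V -> V -> R -> R) -> V -> V -> R -> R).
Variables (f0 : V -> V -> R) (f : V -> V -> R -> R).
Hypothesis f_meas : measurable_phase f.
Hypothesis I_meas : measurable_phase (I f).
Hypothesis f_ge0 : forall x xi t, 0 <= t -> 0 <= f x xi t.
Hypothesis f_sol : kinetic_solution I f0 f.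
Hypothesis I_meso : mesoscopic_interaction I f.
Hypothesis I_int : integrable_interaction I f.

(** A finite extended integral excludes an infinite positive or negative part, because [+oo - +oo]
    is [-oo]. *)
Lemma moment_integrable (w : V -> V -> R) t : 0 <= t ->
  measurable_fun setT (fun z : V * V => w z.1 z.2) ->
  m.-integrable setT (fun z => (f z.1 z.2 t * w z.1 z.2)%:E) <->
  moment f w t \is a fin_num.
Proof.
move=> t0 mw.
have mfw : measurable_fun setT (fun z : V * V => f z.1 z.2 t * w z.1 z.2).
  by apply: measurable_funM => //; exact: measurable_at_time.
rewrite /moment -[(_ \x _)%E]/(@phase_measure R n : set (V * V) -> \bar R).
rewrite -(integral_fin_num_abs m measurableT mfw); split => [/integrableP[]//|fin].
by apply/integrableP; split => //; exact/measurable_EFinP.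
Qed.

Hypothesis mass_fin : mass f 0 \is a fin_num.
Hypothesis energy_fin : energy f 0 \is a fin_num.
Hypothesis moment2_fin : (moment f (fun x _ => (enorm x ^+ 2)%R) 0 < +oo)%E.

Let m1 : measurable_fun setT (fun z : V * V => enorm z.1 ^+ 2).
Proof. by apply: measurable_funX; apply: measurable_enorm; exact: measurable_fst. Qed.
Let m2 : measurable_fun setT (fun z : V * V => enorm z.2 ^+ 2).
Proof. by apply: measurable_funX; apply: measurable_enorm; exact: measurable_snd. Qed.

Let i_mass : m.-integrable setT (fun z => (f z.1 z.2 0 * 1)%:E).
Proof. by apply/(@moment_integrable (fun _ _ => 1)). Qed.

Let i_energy : m.-integrable setT (fun z => (f z.1 z.2 0 * enorm z.2 ^+ 2)%:E).
Proof. by apply/(@moment_integrable (fun _ xi => enorm xi ^+ 2)). Qed.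

Let i_pos : m.-integrable setT (fun z => (f z.1 z.2 0 * enorm z.1 ^+ 2)%:E).
Proof.
apply/(@moment_integrable (fun x _ => enorm x ^+ 2)) => //.
rewrite ge0_fin_numE//; apply: integral_ge0 => z _.
by rewrite lee_fin mulr_ge0 ?f_ge0 ?sqr_ge0.
Qed.

Let i0 : m.-integrable setT (fun z => (f z.1 z.2 0 * weight z)%:E).
Proof.
under eq_fun do rewrite /weight mulrDr EFinD.
exact: integrableD.
Qed.

Lemma integrable_start_sqr :
  m.-integrable setT (fun z => (f z.1 z.2 0 * (enorm z.1 ^+ 2 + enorm z.2 ^+ 2))%:E).
Proof.
under eq_fun do rewrite mulrDr EFinD.
exact: integrableD.
Qed.

Lemma integrable_start (w : V -> V -> R) (C : R) :
  measurable_fun setT (fun z : V * V => w z.1 z.2) ->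
  (forall x xi, `|w x xi| <= C * (enorm x ^+ 2 + enorm xi ^+ 2)) ->
  m.-integrable setT (fun z => (f z.1 z.2 0 * w z.1 z.2)%:E).
Proof.
move=> mw wC.
apply: (@le_integrable _ _ _ m _ _ _
  (fun z => C%:E * (f z.1 z.2 0 * (enorm z.1 ^+ 2 + enorm z.2 ^+ 2))%:E)%E) => //.
- apply/measurable_EFinP/measurable_funM => //; exact: measurable_at_time.
- move=> z _; rewrite lee_fin !normrM mulrCA ler_wpM2l// -normrM.
  by apply: le_trans (wC _ _) _; rewrite ler_norm.
- by apply: integrableZl => //; exact: integrable_start_sqr.
Qed.

(** The balance is applied to [- |xi|^2], which is constant along trajectories, so the error term is
    zero and the inequality comes out in the direction needed for a lower bound on [U]. *)
Lemma energy_ge t : 0 < t ->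
  m.-integrable setT (fun z => (f z.1 z.2 t * enorm z.2 ^+ 2)%:E) /\
  (energy f 0 <= energy f t)%E.
Proof.
move=> t0; pose psi (p : TP) := - enorm p.2.2 ^+ 2.
have mpsi : measurable_fun setT psi.
  by apply: measurableT_comp => //; exact: (measurableT_comp m2 measurable_snd).
have := @transport_balance R n I f0 f f_meas I_meas f_ge0 f_sol I_meso I_int i0 t t0
  psi 1 (fun _ _ => 0) (fun=> 0) mpsi _ _ _ _ (measurable_cst _) 0 _.
case.
- move=> s x; exists 0, 0, (-1) => xi; rewrite /psi/= /dotv big1 => [|i _]; last by rewrite mxE mul0r.
  by rewrite !add0r mulN1r.
- by move=> p _; rewrite /psi normrN ger0_norm ?sqr_ge0// mul1r lerDr.
- move=> z s; rewrite /psi/=; exact: is_derive_cst.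
- by move=> z s _; rewrite mulr0.
- by move=> z; rewrite lexx.
move=> it le_t.
have fN s : (fun z : V * V => (f z.1 z.2 s * psi (s, z))%:E) =
    (fun z => - (f z.1 z.2 s * enorm z.2 ^+ 2)%:E)%E.
  by apply/funext => z; rewrite /psi/= mulrN EFinN.
have {}it : m.-integrable setT (fun z => (f z.1 z.2 t * enorm z.2 ^+ 2)%:E).
  apply: eq_integrable (integrableN it) => // z _ /=.
  by rewrite /psi mulrN opprK.
split=> //; move: le_t; rewrite !fN !integralN/=; try exact: integrable_add_def.
under [X in (_ <= _ + _ * X)%E]eq_integral do rewrite mulr0.
by rewrite integral0 mule0 adde0 leeN2.
Qed.

Let psi0 t (z : V * V) := virial 0 (t, z).

Lemma virial0_ge0 t z : 0 <= psi0 t z.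
Proof.
case: z => x xi; apply: le_trans (virial0_lower t x xi).
by rewrite divr_ge0// addr_ge0 ?dotv_ge0.
Qed.

(* Fatou's lemma in the limit [e -> 0]. *)
Lemma virial_moment_le t : 0 < t ->
  (\int[m]_z (f z.1 z.2 t * psi0 t z)%:E <=
   \int[m]_z (f z.1 z.2 0 * psi0 0 z)%:E)%E.
Proof.
move=> t0; pose e k : R := harmonic k.
have e0 k : 0 < e k by exact: harmonic_gt0.
pose G := trajectory_bound I f t.
have iG : m.-integrable setT (EFin \o G) by exact: integrable_trajectory_bound.
have mG : measurable_fun setT G by apply/measurable_EFinP; exact: (measurable_int m iG).
have bal k := @transport_balance R n I f0 f f_meas I_meas f_ge0 f_sol I_meso I_int i0 t t0
  (virial (e k)) _ (virial_rate (e k)) (virial_defect (e k) t) (measurable_virial (ltW (e0 k)))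
  (virial_quadratic _) (virial_bound (e0 k) (T := t)) (virial_derive (e0 k))
  (fun z s => virial_rate_le (e0 k) z (T := t) (s := s)) (measurable_virial_defect t (ltW (e0 k))) _
  (fun z => virial_defect_bound (e0 k) z (ltW t0)).
have mft s : 0 <= s -> measurable_fun setT (fun z : V * V => f z.1 z.2 s).
  by move=> s0; exact: measurable_at_time.
have mv k s : measurable_fun setT (fun z : V * V => virial (e k) (s, z)).
  exact: (measurableT_comp (measurable_virial (ltW (e0 k))) (pair1_measurable _)).
pose a k := (\int[m]_z (f z.1 z.2 t * virial (e k) (t, z))%:E)%E.
pose b k := (\int[m]_z (f z.1 z.2 0 * virial (e k) (0%R, z))%:E
   + t%:E * \int[m]_z (G z * virial_defect (e k) t z)%:E)%E.
have ab k : (a k <= b k)%E by have [_] := bal k.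
have b1 : (\int[m]_z (f z.1 z.2 0 * virial (e k) (0%R, z))%:E)%E @[k --> \oo] -->
    (\int[m]_z (f z.1 z.2 0 * psi0 0 z)%:E)%E.
  apply: (@dominated_cvg _ _ _ m setT measurableT
    (fun k z => (f z.1 z.2 0 * virial (e k) (0%R, z))%:E) _
    (fun z => 2%:E * (f z.1 z.2 0 * (enorm z.1 ^+ 2 + enorm z.2 ^+ 2))%:E)%E).
  - by move=> k; apply/measurable_EFinP/measurable_funM => //; exact: mft.
  - move=> z _; apply/cvg_EFin; first by near=> k.
    by apply: cvgM; [exact: cvg_cst | exact: virial_cvg].
  - by move=> z _.
  - by apply: integrableZl => //; exact: integrable_start_sqr.
  - move=> k z _; rewrite lee_fin ger0_norm ?mulr_ge0 ?f_ge0 ?virial_ge0//.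
    by rewrite mulrCA ler_wpM2l ?f_ge0 ?virial_start_le.
(* The defect is bounded independently of [k] and tends to 0, while [G] is an integrable majorant
   fixed in advance. *)
have b2 : (\int[m]_z (G z * virial_defect (e k) t z)%:E)%E @[k --> \oo] --> 0%E.
  rewrite -[X in _ --> X](integral0 m setT).
  apply: (@dominated_cvg _ _ _ m setT measurableT
    (fun k z => (G z * virial_defect (e k) t z)%:E) _
    (fun z => (6 * (2 * t + 1))%:E * `|(G z)%:E|)%E).
  - by move=> k; apply/measurable_EFinP/measurable_funM => //; exact: measurable_virial_defect (ltW (e0 k)).
  - move=> z _; apply/cvg_EFin; first by near=> k.
    rewrite -(mulr0 (G z)).
    by apply: cvgM; [exact: cvg_cst | exact: virial_defect_cvg].
  - by move=> z _.
  - by apply: integrableZl => //; exact: (integrable_abse iG).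
  - move=> k z _; rewrite lee_fin normrM mulrC ler_wpM2r//.
    have /andP[d0 d1] := virial_defect_bound (e0 k) z (ltW t0).
    by rewrite ger0_norm.
have bl : b k @[k --> \oo] --> (\int[m]_z (f z.1 z.2 0 * psi0 0 z)%:E)%E.
  rewrite -[X in _ --> X]adde0 -[X in _ --> (_ + X)%E](mule0 t%:E).
  apply: cvgeD => //; first by rewrite mule0 fin_num_adde_defl.
  exact: cvgeZl.
apply: le_trans (limn_einf_le_lim ab bl).
(* At time [t] no majorant uniform in [e] is at hand, since [virial_bound] degenerates like [e^-1];
   nonnegativity of the virial makes Fatou applicable instead. *)
apply: le_trans (fatou m measurableT _ _).
- rewrite le_eqVlt; apply/orP; left; apply/eqP; apply: eq_integral => z _.
  apply/esym; apply: (cvg_limn_einf_sup _).1.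
  apply/cvg_EFin; first by near=> k.
  by apply: cvgM; [exact: cvg_cst | exact: virial_cvg].
- move=> k; apply/measurable_EFinP/measurable_funM => //; by apply: mft; exact: ltW.
- by move=> k z _; rewrite lee_fin mulr_ge0 ?f_ge0 ?(ltW t0)// virial_ge0.
Unshelve. all: by end_near. Qed.
End moments.

(** * Pointwise comparison of [|x||xi|], [x . xi] and the conserved virial *)

Section pointwise.
Context {R : realType} {n : nat}.
Local Notation V := 'rV[R]_n.
Implicit Types (x xi : V) (t : R).

Lemma enormM_le_mean (y xi : V) : enorm y * enorm xi <= (dotv y y + dotv xi xi) / 2.
Proof. have := sqr_ge0 (enorm y - enorm xi); rewrite -!sqr_enorm; lra. Qed.

Lemma enorm_translate_le t x xi : 0 <= t ->
  enorm x * enorm xi <= enorm (x - t *: xi) * enorm xi + t * dotv xi xi.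
Proof.
move=> t0; have := enormD_le (x - t *: xi) (t *: xi).
rewrite subrK enormZ (ger0_norm t0) => xy.
rewrite -sqr_enorm expr2 mulrA -mulrDl.
by rewrite ler_wpM2r// enorm_ge0.
Qed.

(** With [y = x - t xi], [|x||xi| <= |y||xi| + t |xi|^2]. The virial dominates the first term and
    half of [|xi|^2], whence [1 + 2 * t]. The time-dependent constant serves only to make [U(t)]
    finite. *)
Lemma enormM_le_virial t x xi : 0 <= t ->
  enorm x * enorm xi <= (1 + 2 * t) * virial 0 (t, (x, xi)).
Proof.
move=> t0; have := enorm_translate_le x xi t0.
have := enormM_le_mean (x - t *: xi) xi.
have := virial0_lower t x xi; have := dotv_ge0 xi; have := dotv_ge0 (x - t *: xi).
move: (dotv _ _) (virial _ _) => a p a0 c0 ap m1 m2.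
have : t * ((a + dotv xi xi) / 2) <= t * p by rewrite ler_wpM2l.
have : 0 <= t * a by rewrite mulr_ge0.
lra.
Qed.

(** Both [|x||xi|] and [x . xi] contain the growing term [t |xi|^2], which cancels in the
    difference; the remainder [|y||xi| - y . xi] is free of [t]. *)
Lemma defect_le_virial t x xi : 0 <= t ->
  enorm x * enorm xi - dotv x xi <= virial 0 (t, (x, xi)).
Proof.
move=> t0; have := enorm_translate_le x xi t0.
have := enormM_le_mean (x - t *: xi) xi.
have := dotv_ge0 xi; have := dotv_ge0 (x - t *: xi).
rewrite virial0E.
have -> : dotv x xi = dotv (x - t *: xi) xi + t * dotv xi xi.
  by rewrite dotvDl dotvNl dotvZl; ring.
lra.
Qed.

(** Here [t |xi|^2 = x . xi - y . xi] with [y = x - t xi]; the first term is at most [|x||xi|] and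
    the second at most the virial. *)
Lemma energy_le_virial t x xi :
  t * enorm xi ^+ 2 <= enorm x * enorm xi + virial 0 (t, (x, xi)).
Proof.
have := le_trans (ler_norm _) (dotv_le_enorm x xi).
have := dotv_ge0 xi; have := dotv_ge0 (x - t *: xi).
rewrite virial0E sqr_enorm.
have -> : dotv x xi = dotv (x - t *: xi) xi + t * dotv xi xi.
  by rewrite dotvDl dotvNl dotvZl; ring.
lra.
Qed.

Lemma virial0_start x xi :
  virial 0 (0 : R, (x, xi)) = enorm x ^+ 2 + enorm xi ^+ 2 - dotv x xi.
Proof. by rewrite virial0E scale0r subr0 !sqr_enorm; ring. Qed.

Lemma norm_dotv_le_sqr x xi : `|dotv x xi| <= 1 * (enorm x ^+ 2 + enorm xi ^+ 2).
Proof.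
apply: le_trans (dotv_le_enorm x xi) _; apply: le_trans (enormM_le_mean x xi) _.
rewrite !sqr_enorm; have := dotv_ge0 x; have := dotv_ge0 xi; lra.
Qed.

End pointwise.

(** * Positivity of the energy *)

Section velocity_hyperplane.
Context {R : realType} {n : nat}.
Local Notation V := 'rV[R]_n.+1.

Lemma phase_measure_velocity_hyperplane :
  @phase_measure R n.+1 [set z : V * V | z.2 ord0 ord0 = 0] = 0%E.
Proof.
have mN : measurable [set v : V | v ord0 ord0 = 0].
  rewrite -[X in measurable X]setTI.
  exact: (measurable_coord (T := R) ord0 measurableT (measurable_set1 0)).
have N0 : lebesgue_rV R n.+1 [set v : V | v ord0 ord0 = 0] = 0%E.
  rewrite /= /lebesgue_rV_step /pushforward.
  rewrite (_ : _ @^-1` _ = [set (0 : R)] `*` setT); last first.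
    by apply/seteqP; split => -[a w] /=; rewrite !mxE unlift_none//= => -[].
  rewrite product_measure1E//.
  by rewrite [X in (X * _)%E]lebesgue_measure_set1 mul0e.
rewrite /phase_measure (_ : [set z | _] = setT `*` [set v : V | v ord0 ord0 = 0]).
  by rewrite product_measure1E// N0 mule0.
by apply/seteqP; split => -[x xi] //= [].
Qed.

End velocity_hyperplane.

(** Zero energy forces [f |xi|^2 = 0] almost everywhere. In positive dimension [xi] is nonzero off a
    null hyperplane, hence [f = 0] almost everywhere and the mass vanishes. *)
Lemma energy_gt0 {R : realType} {n : nat} (f : 'rV[R]_n -> 'rV[R]_n -> R -> R) :
  (0 < n)%N -> measurable_phase f ->
  (forall x xi (t : R), 0 <= t -> 0 <= f x xi t) ->
  (0 < mass f 0)%E -> (0 < energy f 0)%E.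
Proof.
case: n f => [//|n] f _ f_meas f_ge0 mass0.
have f0_ge0 x xi : 0 <= f x xi 0 by exact: f_ge0.
have mf := measurable_at_time f_meas (lexx 0).
have mfe : measurable_fun setT (fun z : 'rV[R]_n.+1 * 'rV[R]_n.+1 => f z.1 z.2 0 * enorm z.2 ^+ 2).
  apply: measurable_funM => //; apply: measurable_funX; apply: measurable_enorm.
  exact: measurable_snd.
rewrite lt_neqAle; apply/andP; split; last first.
  by apply: integral_ge0 => z _; rewrite lee_fin mulr_ge0 ?sqr_ge0.
apply: contraTneq mass0 => E0; rewrite -leNgt le_eqVlt; apply/orP; left; apply/eqP.
rewrite /mass /moment -[(_ \x _)%E]/(@phase_measure R n.+1 : set _ -> \bar R).
transitivity (\int[@phase_measure R n.+1]_z (cst 0%E z))%E; last by rewrite integral0.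
apply: ae_eq_integral => //.
  by apply/measurable_EFinP; under eq_fun do rewrite mulr1.
have : ae_eq (@phase_measure R n.+1) setT
    (fun z => (f z.1 z.2 0 * enorm z.2 ^+ 2)%:E) (cst 0%E).
  apply/(ae_eq_integral_abs (@phase_measure R n.+1) measurableT).
    exact/measurable_EFinP.
  rewrite [RHS]E0; apply: eq_integral => z _.
  by rewrite gee0_abs// lee_fin mulr_ge0 ?sqr_ge0.
have : {ae @phase_measure R n.+1, forall z : 'rV[R]_n.+1 * 'rV[R]_n.+1, z.2 ord0 ord0 != 0}.
  exists [set z : 'rV[R]_n.+1 * 'rV[R]_n.+1 | z.2 ord0 ord0 = 0]; split.
  - rewrite -[X in measurable X]setTI.
    have mc : measurable_fun setT (fun z : 'rV[R]_n.+1 * 'rV[R]_n.+1 => z.2 ord0 ord0).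
      exact: (measurableT_comp (measurable_coord (T := R) ord0) measurable_snd).
    exact: (mc measurableT _ (measurable_set1 0)).
  - exact: phase_measure_velocity_hyperplane.
  - by move=> z /= /negP; rewrite negbK => /eqP.
apply: filterS2 => z z0 /(_ I)[] /eqP; rewrite mulf_eq0 => /orP[/eqP->|]; first by rewrite mul0r.
rewrite sqr_enorm => /eqP zz; exfalso; move: z0 => /negP; apply.
by rewrite (dotv_eq0 zz).
Qed.

(** * The bound on [U - A] and the linear lower bound for [U] *)

Section main.
Context {R : realType} {n : nat}.
Local Notation V := 'rV[R]_n.
Local Notation m := (@phase_measure R n).
Variables (I : (V -> V -> R -> R) -> V -> V -> R -> R).
Variables (f0 : V -> V -> R) (f : V -> V -> R -> R).
Hypothesis f_meas : measurable_phase f.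
Hypothesis I_meas : measurable_phase (I f).
Hypothesis f_ge0 : forall x xi t, 0 <= t -> 0 <= f x xi t.
Hypothesis f_sol : kinetic_solution I f0 f.
Hypothesis I_meso : mesoscopic_interaction I f.
Hypothesis I_int : integrable_interaction I f.
Hypothesis mass_fin : mass f 0 \is a fin_num.
Hypothesis energy_fin : energy f 0 \is a fin_num.
Hypothesis moment2_fin : (moment f (fun x _ => (enorm x ^+ 2)%R) 0 < +oo)%E.

Let B := (\int[m]_z (f z.1 z.2 0 * virial 0 (0%R, z))%:E)%E.

Let mdot : measurable_fun setT (fun z : V * V => dotv z.1 z.2).
Proof. by apply: measurable_dotv; [exact: measurable_fst | exact: measurable_snd]. Qed.

Let i_dot : m.-integrable setT (fun z => (f z.1 z.2 0 * dotv z.1 z.2)%:E).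
Proof.
exact: (integrable_start f_meas f_ge0 energy_fin moment2_fin mdot (@norm_dotv_le_sqr R n)).
Qed.

Lemma virial_startE :
  (B = moment f (fun x xi => enorm x ^+ 2 + enorm xi ^+ 2)%R 0 - angular_momentum f 0)%E.
Proof.
have i_sqr := integrable_start_sqr f_meas f_ge0 energy_fin moment2_fin.
rewrite /angular_momentum /moment -[(_ \x _)%E]/(@phase_measure R n : set _ -> \bar R).
rewrite -integralB//; apply: eq_integral => -[x xi] _ /=.
by rewrite -EFinB -mulrBr; congr (_ * _)%:E; exact: virial0_start.
Qed.

Lemma virial_start_fin_num : B \is a fin_num.
Proof.
have i_sqr := integrable_start_sqr f_meas f_ge0 energy_fin moment2_fin.
rewrite virial_startE fin_numB; apply/andP; split; exact: integrable_fin_num.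
Qed.

Variable t : R.
Hypothesis t_ge0 : 0 <= t.

Let virial_le : (\int[m]_z (f z.1 z.2 t * virial 0 (t, z))%:E <= B)%E.
Proof.
move: t_ge0; rewrite le_eqVlt => /predU1P[<-//|t0].
exact: (virial_moment_le f_meas I_meas f_ge0 f_sol I_meso I_int mass_fin energy_fin moment2_fin t0).
Qed.

Let mv : measurable_fun setT (fun z : V * V => f z.1 z.2 t * virial 0 (t, z)).
Proof.
apply: measurable_funM; first exact: measurable_at_time.
exact: (measurableT_comp (measurable_virial (lexx 0)) (pair1_measurable _)).
Qed.

Let v_ge0 z : 0 <= f z.1 z.2 t * virial 0 (t, z).
Proof. by rewrite mulr_ge0 ?f_ge0 ?virial0_ge0. Qed.

Let i_virial : m.-integrable setT (fun z => (f z.1 z.2 t * virial 0 (t, z))%:E).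
Proof.
apply/integrableP; split; first exact/measurable_EFinP.
under eq_integral do rewrite gee0_abs ?lee_fin//.
by apply: le_lt_trans virial_le _; rewrite ltey_eq virial_start_fin_num.
Qed.

Let i_uncertainty : m.-integrable setT (fun z => (f z.1 z.2 t * (enorm z.1 * enorm z.2))%:E).
Proof.
apply: (@le_integrable _ _ _ m _ _ _ (fun z => (1 + 2 * t)%:E * (f z.1 z.2 t * virial 0 (t, z))%:E)%E) => //.
- apply/measurable_EFinP/measurable_funM; first exact: measurable_at_time.
  by apply: measurable_funM; apply: measurable_enorm; [exact: measurable_fst | exact: measurable_snd].
- move=> [x xi] _; rewrite lee_fin ger0_norm ?mulr_ge0 ?f_ge0 ?enorm_ge0//.
  apply: le_trans (ler_norm _); rewrite [leRHS]mulrCA ler_wpM2l ?f_ge0//.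
  exact: enormM_le_virial.
- exact: integrableZl.
Qed.

Let i_angular : m.-integrable setT (fun z => (f z.1 z.2 t * dotv z.1 z.2)%:E).
Proof.
apply: (le_integrable _ _ _ i_uncertainty) => //.
- by apply/measurable_EFinP/measurable_funM => //; exact: measurable_at_time.
- move=> z _; rewrite lee_fin !normrM ler_wpM2l// -normrM.
  by apply: le_trans (dotv_le_enorm _ _) _; rewrite ler_norm.
Qed.

Lemma uncertainty_fin_num : uncertainty f t \is a fin_num.
Proof. exact: integrable_fin_num i_uncertainty. Qed.

Lemma angular_momentum_fin_num : angular_momentum f t \is a fin_num.
Proof. exact: integrable_fin_num i_angular. Qed.

Lemma angular_defect_le : (uncertainty f t - angular_momentum f t <= B)%E.
Proof.
apply: le_trans virial_le.
rewrite /uncertainty /angular_momentum /moment -[(_ \x _)%E]/(@phase_measure R n : set _ -> \bar R).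
rewrite -integralB//; apply: le_integral => //; first exact: integrableB.
move=> [x xi] _; rewrite -EFinB lee_fin -mulrBr ler_wpM2l ?f_ge0//.
exact: defect_le_virial.
Qed.

Lemma energy_le_uncertainty : (t%:E * energy f 0 <= uncertainty f t + B)%E.
Proof.
have U0 : (0 <= uncertainty f t)%E.
  by apply: integral_ge0 => z _; rewrite lee_fin !mulr_ge0 ?f_ge0 ?enorm_ge0.
have B0 : (0 <= B)%E.
  by apply: le_trans virial_le; apply: integral_ge0 => z _; rewrite lee_fin.
(* [energy_ge] covers positive times; at [t = 0] the left side vanishes. *)
have [t0|t0] := leP t 0.
  by apply: (@le_trans _ _ 0%E); [rewrite (_ : t = 0) ?mul0e//; apply/eqP; rewrite eq_le t0 | exact: adde_ge0].
have [i_en en_le] := energy_ge f_meas I_meas f_ge0 f_sol I_meso I_int mass_fin energy_fin t0.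
apply: (@le_trans _ _ (t%:E * energy f t)%E).
  by apply: lee_wpmul2l => //; rewrite lee_fin.
apply: (@le_trans _ _ (uncertainty f t + \int[m]_z (f z.1 z.2 t * virial 0 (t, z))%:E)%E); last first.
  by rewrite leeD2l.
rewrite /uncertainty /energy /moment -[(_ \x _)%E]/(@phase_measure R n : set _ -> \bar R).
rewrite -integralZl// -integralD//; apply: le_integral => //.
- exact: integrableZl.
- exact: integrableD.
- move=> [x xi] _ /=; rewrite -EFinM -EFinD lee_fin -mulrDr mulrCA ler_wpM2l ?f_ge0//.
  exact: energy_le_virial.
Qed.

End main.

(* The first conjunct says that U(t) and A(t) converge, so that U(t) - A(t) is
   an honest real number and not an extended-real subtraction of infinities. *)
Theorem theorem2p2 (R : realType) (n : nat) (n_gt0 : (0 < n)%N)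
    (I : ('rV[R]_n -> 'rV[R]_n -> R -> R) -> 'rV[R]_n -> 'rV[R]_n -> R -> R)
    (f0 : 'rV[R]_n -> 'rV[R]_n -> R) (f : 'rV[R]_n -> 'rV[R]_n -> R -> R)
    (f_meas : measurable_phase f)
    (I_meas : measurable_phase (I f))
    (f_ge0 : forall x xi (t : R), 0 <= t -> 0 <= f x xi t)
    (f_sol : kinetic_solution I f0 f)
    (I_meso : mesoscopic_interaction I f)
    (I_int : integrable_interaction I f)
    (mass_fin : mass f 0 \is a fin_num)
    (energy_fin : energy f 0 \is a fin_num)
    (momentum_fin : forall i, momentum f i 0 \is a fin_num)
    (moment2_fin : (moment f (fun x _ => (enorm x ^+ 2)%R) 0 < +oo)%E) :
  [/\ forall t : R, 0 <= t ->
        uncertainty f t \is a fin_num /\ angular_momentum f t \is a fin_num,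
      (relative_angular_norm f <=
         moment f (fun x xi => (enorm x ^+ 2 + enorm xi ^+ 2)%R) 0
         - angular_momentum f 0)%E &
      (0 < mass f 0)%E -> uncertainty f t @[t --> +oo%R] --> +oo%E].
Proof.
split.
- move=> t t0; split.
    exact: (uncertainty_fin_num f_meas I_meas f_ge0 f_sol I_meso I_int mass_fin energy_fin moment2_fin t0).
  exact: (angular_momentum_fin_num f_meas I_meas f_ge0 f_sol I_meso I_int mass_fin energy_fin moment2_fin t0).
- apply: ge_ereal_sup => _ [t /= t0 <-].
  rewrite -(virial_startE f_meas f_ge0 energy_fin moment2_fin).
  exact: (angular_defect_le f_meas I_meas f_ge0 f_sol I_meso I_int mass_fin energy_fin moment2_fin t0).
- move=> mass_gt0.
  have := energy_gt0 n_gt0 f_meas f_ge0 mass_gt0.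
  have B_fin := virial_start_fin_num f_meas f_ge0 energy_fin moment2_fin.
  have UB t t0 := @energy_le_uncertainty R n I f0 f f_meas I_meas f_ge0 f_sol I_meso I_int
    mass_fin energy_fin moment2_fin t t0.
  move: B_fin UB; set B := (\int[_]_z _)%E; case: B => [b| |]//.
  move: energy_fin; case: (energy f 0) => [e| |]// _ _ UB; rewrite lte_fin => e0.
  (* Since [U(t) >= t e - b], the level [A] is reached once [t >= (A + b) / e]; this is where
     [e > 0] enters. *)
  apply/cvgeyPge => A; near=> t.
  have t0 : 0 <= t by near: t; apply: nbhs_pinfty_ge; rewrite num_real.
  have := UB t t0; rewrite -leeBlDr// -EFinM -EFinB; apply: le_trans.
  rewrite lee_fin lerBrDr -ler_pdivrMr; [|exact: e0].
  by near: t; apply: nbhs_pinfty_ge; rewrite num_real.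
Unshelve. all: by end_near. Qed.
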